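(* Let $r>k_1$ and let $(\mu_r,\nu_r):I\to M$ be a geodesic with respect to the metric $G_r+g_2$, with $\mu_r(0)=x_0$, $\nu_r(0)=y_0$, $\dot\mu_r(0)=X_0$ and $\dot\nu_r(0)=Y_0$. Let $\varphi_r,a_r,\gamma_r=\mu_r\circ\varphi_r$ and $\psi_r,b_r,\tau_r=\nu_r\circ\psi_r$ be obtained from $(\mu_r,\nu_r)$ as described in the context. Suppose that $$a_r^2\,\frac{1+rk(x_0)}{k(x_0)}\,g_1(X_0,X_0)=b_r^2\,g_2(Y_0,Y_0).$$ Then the curve $(\gamma_r,\tau_r):I\to M$ is a geodesic with respect to the metric $g$. Moreover $(\mu_r(0),\nu_r(0))=(x_0,y_0)$ and $(\mu_r(1),\nu_r(1))=(\gamma_r(1),\tau_r(1))$.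
   Context: $(M_1,g_1)$ and $(M_2,g_2)$ are connected, complete Riemannian manifolds, and $k:M_1\to\mathbb R$ is a $C^\infty$ function with $k_0:=\inf_{x\in M_1}k(x)>0$. Put $M:=M_1\times M_2$ and let $g:=g_1-k\,g_2$ be the semi-Riemannian warped product metric on $M$. If $k$ is bounded, put $K_0:=\sup_{x\in M_1}k(x)$ and $k_1:=-K_0^{-1}$; if $k$ is unbounded from above, put $k_1:=0$. For $r>k_1$, $G_r:=(\frac1k+r)g_1$ is a Riemannian metric on $M_1$, and $G_r+g_2$ is the product Riemannian metric on $M$. $I:=[0,1]$. Reparametrizations: given smooth $\mu_r:I\to M_1$, $\varphi_r:I\to I$ is the unique diffeomorphism with $\varphi_r(0)=0$, $\varphi_r(1)=1$, $\dot\varphi_r=a_r\left(\frac{1+rk}{k}\right)\circ\mu_r\circ\varphi_r$, where $a_r:=\int_0^1\frac{k(\mu_r(\xi))}{1+rk(\mu_r(\xi))}\,d\xi$; put $\gamma_r:=\mu_r\circ\varphi_r$. Then $\psi_r:I\to I$ is the unique diffeomorphism with $\psi_r(0)=0$, $\psi_r(1)=1$, $\dot\psi_r=\frac{b_r}{k\circ\gamma_r}$, where $b_r:=\left(\int_0^1\frac{1}{k(\gamma_r(\xi))}\,d\xi\right)^{-1}$; given smooth $\nu_r:I\to M_2$, put $\tau_r:=\nu_r\circ\psi_r$. *)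

(* Defs.v *)
From HB Require Import structures.
From mathcomp Require Import all_boot all_order all_algebra.
From mathcomp Require Import all_classical all_reals all_analysis.

Set Implicit Arguments.
Unset Strict Implicit.
Unset Printing Implicit Defensive.

Import Order.TTheory GRing.Theory Num.Theory.
Import numFieldNormedType.Exports.

Local Open Scope classical_set_scope.
Local Open Scope ring_scope.

(* Iterated directional derivatives: [iterD [:: v1; ..; vm] f] is
   D_v1 (... (D_vm f)).  For an open U, [smooth_on U f] says that all of them
   are (Frechet) differentiable on U, i.e. that f is C^oo on U. *)
Definition iterD (R : realType) (V W : normedModType R) (s : seq V)
    (f : V -> W) : V -> W :=
  foldr (fun v h => 'D_v h) f s.

Definition smooth_on (R : realType) (V W : normedModType R) (U : set V)
    (f : V -> W) : Prop :=
  forall (s : seq V) (x : V), U x -> differentiable (iterD s f) x.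

Lemma near_eq_differentiable (R : realType) (V W : normedModType R)
    (f g : V -> W) (x : V) :
  {near x, f =1 g} -> differentiable g x -> differentiable f x.
Proof.
move=> fg dg; have [cg Eg] := (iffLR (diff_locallyP _ _)) dg.
have E : f \o shift x = cst (f x) + 'd g x +o_ 0 id.
  apply/eqaddoP => e e0; move/eqaddoP: Eg => /(_ e e0).
  have : \forall y \near 0, f (y + x) = g (y + x).
    by apply: filterS (iffLR (nbhs0P _ _) fg) => y; rewrite addrC.
  apply: filterS2 => y Ey; rewrite !fctE /= Ey (nbhs_singleton fg).
  by [].
have D := diff_unique cg E.
apply/diff_locallyP; split; first by rewrite D.
by rewrite D.
Qed.

Lemma diff_sandwich (R : realType) (A B C D : normedModType R)
    (i : {linear C -> D}) (l : {linear A -> B}) (f : B -> C) (u : A) :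
  continuous i -> continuous l -> differentiable f (l u) ->
  differentiable (fun w => i (f (l w))) u /\
  forall v, 'D_v (fun w => i (f (l w))) u = i ('D_(l v) f (l u)).
Proof.
move=> ci cl df.
have dl : differentiable l u by exact: linear_differentiable.
have di w : differentiable i w by exact: linear_differentiable.
have d1 : differentiable (f \o l) u by exact: differentiable_comp.
have d2 : differentiable (i \o (f \o l)) u by exact: differentiable_comp.
split=> [|v]; first exact: d2.
rewrite (deriveE _ d2) (deriveE _ df).
by rewrite (diff_comp d1 (di _)) (diff_comp dl df) (diff_lin _ ci) (diff_lin _ cl).
Qed.

Section product_maps.
Variables (R : realType) (n1 n2 m1 m2 : nat).

Definition prod_map (f1 : 'rV[R]_n1 -> 'rV[R]_m1)
    (f2 : 'rV[R]_n2 -> 'rV[R]_m2) (u : 'rV[R]_(n1 + n2)) : 'rV[R]_(m1 + m2) :=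
  row_mx (f1 (lsubmx u)) (f2 (rsubmx u)).

Lemma row_mx_continuous :
  continuous (fun w : 'rV[R]_m1 * 'rV[R]_m2 => row_mx w.1 w.2).
Proof.
move=> u A /nbhs_ballP[e /= e0 eA].
apply/nbhs_ballP; exists e => //= v [[_ uv1] [_ uv2]].
apply: eA; split => // i j.
by rewrite !mxE; case: splitP => k _; [exact: uv1|exact: uv2].
Qed.

Lemma prod_map_is_diff (f1 : 'rV[R]_n1 -> 'rV[R]_m1)
    (f2 : 'rV[R]_n2 -> 'rV[R]_m2) (u : 'rV[R]_(n1 + n2)) :
  differentiable f1 (lsubmx u) -> differentiable f2 (rsubmx u) ->
  differentiable (prod_map f1 f2) u /\
  forall v, 'D_v (prod_map f1 f2) u =
    row_mx ('D_(lsubmx v) f1 (lsubmx u)) ('D_(rsubmx v) f2 (rsubmx u)).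
Proof.
move=> df1 df2.
have [il ilE] : exists il : {linear 'rV[R]_m1 -> 'rV[R]_(m1 + m2)},
    forall w, il w = row_mx w 0.
  exists (mulmxr (row_mx 1%:M 0)) => w.
  by rewrite /= mul_mx_row mulmx1 mulmx0.
have [ir irE] : exists ir : {linear 'rV[R]_m2 -> 'rV[R]_(m1 + m2)},
    forall w, ir w = row_mx 0 w.
  exists (mulmxr (row_mx 0 1%:M)) => w.
  by rewrite /= mul_mx_row mulmx1 mulmx0.
have cil : continuous il.
  move=> w A /nbhs_ballP[e /= e0 eA].
  apply/nbhs_ballP; exists e => //= v [_ wv]; apply: eA; split => // i j.
  rewrite (ilE w) (ilE v) !mxE; case: splitP => k _; first exact: wv.
  by rewrite !mxE; exact: ballxx.
have cir : continuous ir.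
  move=> w A /nbhs_ballP[e /= e0 eA].
  apply/nbhs_ballP; exists e => //= v [_ wv]; apply: eA; split => // i j.
  rewrite (irE w) (irE v) !mxE; case: splitP => k _; last exact: wv.
  by rewrite !mxE; exact: ballxx.
have [d1 D1] := diff_sandwich cil (@continuous_lsubmx R 1 n1 n2) df1.
have [d2 D2] := diff_sandwich cir (@continuous_rsubmx R 1 n1 n2) df2.
have E : prod_map f1 f2 =
    (fun w => il (f1 (lsubmx w))) + (fun w => ir (f2 (rsubmx w))).
  apply/funext => w; rewrite /prod_map !fctE ilE irE add_row_mx.
  by rewrite addr0 add0r.
rewrite E; split=> [|v]; first exact: differentiableD d1 d2.
rewrite deriveD; [|exact: diff_derivable d1|exact: diff_derivable d2].
by rewrite D1 D2 ilE irE add_row_mx addr0 add0r.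
Qed.

End product_maps.

Lemma prod_map_smooth (R : realType) (n1 n2 m1 m2 : nat)
    (f1 : 'rV[R]_n1 -> 'rV[R]_m1) (f2 : 'rV[R]_n2 -> 'rV[R]_m2)
    (U1 : set 'rV[R]_n1) (U2 : set 'rV[R]_n2) :
  open U1 -> open U2 -> smooth_on U1 f1 -> smooth_on U2 f2 ->
  smooth_on ((lsubmx : 'rV[R]_(n1 + n2) -> 'rV[R]_n1) @^-1` U1 `&`
             (rsubmx : 'rV[R]_(n1 + n2) -> 'rV[R]_n2) @^-1` U2)
    (prod_map f1 f2).
Proof.
move=> oU1 oU2 sf1 sf2; set U := (X in smooth_on X).
have oU : open U.
  apply: openI; apply: open_comp => // x _.
    exact: continuous_lsubmx.
  exact: continuous_rsubmx.
pose g s := prod_map (iterD (map lsubmx s) f1) (iterD (map rsubmx s) f2).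
have dg s x : U x -> differentiable (g s) x.
  by case=> x1 x2; apply: (proj1 (prod_map_is_diff _ _)); [exact: sf1|exact: sf2].
have Eg s x : U x -> iterD s (prod_map f1 f2) x = g s x.
  elim: s x => [//|v s IH] x Ux /=.
  rewrite (@near_eq_derive _ _ _ _ (g s)); last 1 first.
    by near=> y; apply: IH; near: y; exact: open_nbhs_nbhs.
  have [x1 x2] := Ux.
  by rewrite /g (proj2 (prod_map_is_diff (sf1 _ _ x1) (sf2 _ _ x2))).
move=> s x Ux; apply: (@near_eq_differentiable _ _ _ _ (g s)); last exact: dg.
by near=> y; apply: Eg; near: y; exact: open_nbhs_nbhs.
Unshelve. all: by end_near. Qed.

(* Smooth manifolds modelled on R^n, given by a (not necessarily maximal)
   indexed smooth atlas.  [par i] is the inverse of the chart [crd i]; both are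
   total functions, meaningful only on [dom i] and [crd i @` dom i]. *)
Record manifold (R : realType) (n : nat) := Manifold {
  pt :> topologicalType;
  idx : Type;
  dom : idx -> set pt;
  crd : idx -> pt -> 'rV[R]_n;
  par : idx -> 'rV[R]_n -> pt;
  pt_hausdorff : hausdorff_space pt;
  pt_second_countable : @second_countable pt;
  dom_cover : forall x, exists i, dom i x;
  dom_open : forall i, open (dom i);
  img_open : forall i, open (crd i @` dom i);
  crdK : forall i x, dom i x -> par i (crd i x) = x;
  crd_continuous : forall i x, dom i x -> {for x, continuous (crd i)};
  par_continuous : forall i x, dom i x -> {for crd i x, continuous (par i)};
  crd_smooth : forall i j,
    smooth_on (crd i @` (dom i `&` dom j)) (crd j \o par i)
}.
Arguments dom {R n m} i.
Arguments crd {R n m} i.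
Arguments par {R n m} i.

Section manifold_theory.
Variables (R : realType) (n : nat) (M : manifold R n).

Definition smooth_function (f : M -> R) : Prop :=
  forall i : idx M, smooth_on (crd i @` dom i) (f \o par i : 'rV[R]_n -> R^o).

Definition chart_at (x : M) : idx M := projT1 (cid (dom_cover x)).

(* A tangent vector at x is the family of its components in all the charts
   around x, subject to the transformation law (the values at the other charts
   are irrelevant); ['J f p] is the Jacobian in the
   row-vector convention. *)
Record tangent (x : M) := Tangent {
  comp :> idx M -> 'rV[R]_n;
  comp_change : forall i j, dom i x -> dom j x ->
    comp j = comp i *m 'J (crd j \o par i) (crd i x)
}.

(* [T i u] is the matrix of components, in the chart i, of a covariant
   2-tensor at the point of coordinates u. *)
Definition tensor2 := idx M -> 'rV[R]_n -> 'M[R]_n.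

Definition smooth_tensor2 (T : tensor2) : Prop :=
  (forall i a b, smooth_on (crd i @` dom i) (fun u => T i u a b : R^o)) /\
  (forall i j x, dom i x -> dom j x ->
    let J := 'J (crd j \o par i) (crd i x) in
    T i (crd i x) = J *m T j (crd j x) *m J^T).

Definition riemannian (g : tensor2) : Prop :=
  [/\ smooth_tensor2 g,
      (forall i x, dom i x -> (g i (crd i x))^T = g i (crd i x)) &
      (forall i x, dom i x -> forall v : 'rV[R]_n, v != 0 ->
        0 < (v *m g i (crd i x) *m v^T) 0 0)].

Definition inner (g : tensor2) (x : M) (X Y : tangent x) : R :=
  (X (chart_at x) *m g (chart_at x) (crd (chart_at x) x)
    *m (Y (chart_at x))^T) 0 0.

Definition scale_tensor2 (f : M -> R) (g : tensor2) : tensor2 :=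
  fun i u => f (par i u) *: g i u.

Definition partial (a : 'I_n) (f : 'rV[R]_n -> R) (u : 'rV[R]_n) : R :=
  'D_(delta_mx 0 a) (f : 'rV[R]_n -> R^o) u.

(* Gamma^a_{bc} = 1/2 g^{al} (d_b g_{lc} + d_c g_{lb} - d_l g_{bc}) *)
Definition christoffel (g : tensor2) (i : idx M) (u : 'rV[R]_n)
    (a b c : 'I_n) : R :=
  2^-1 * \sum_(l < n) invmx (g i u) a l *
    (partial b (fun w => g i w l c) u + partial c (fun w => g i w l b) u
     - partial l (fun w => g i w b c) u).

End manifold_theory.

Lemma transition_open (R : realType) (n : nat) (M : manifold R n)
    (i j : idx M) : open (crd i @` (dom i `&` dom j)).
Proof.
rewrite openE => _ [x [ix jx] <-].
have Hj : \forall u \near crd i x, dom j (par i u).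
  move: (par_continuous ix) => /(_ (dom j)); rewrite nbhs_simpl /=; apply.
  by apply: open_nbhs_nbhs; split; [exact: dom_open|rewrite crdK].
have Hi : \forall u \near crd i x, (crd i @` dom i) u.
  by apply: open_nbhs_nbhs; split; [exact: img_open|exists x].
apply: filterS2 Hj Hi => u ju [y iy yu]; exists y => //; split=> //.
by move: ju; rewrite -yu crdK.
Qed.

Section product_manifold.
Variables (R : realType) (n1 n2 : nat).
Variables (M1 : manifold R n1) (M2 : manifold R n2).

Let T := (M1 * M2)%type.
Let I := (idx M1 * idx M2)%type.
Let pdom (i : I) : set T := dom i.1 `*` dom i.2.
Let pcrd (i : I) (x : T) : 'rV[R]_(n1 + n2) :=
  row_mx (crd i.1 x.1) (crd i.2 x.2).
Let ppar (i : I) (u : 'rV[R]_(n1 + n2)) : T :=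
  (par i.1 (lsubmx u), par i.2 (rsubmx u)).

Let pt_hausdorff : hausdorff_space T.
Proof.
move=> [p1 p2] [q1 q2] clpq; congr pair; apply: pt_hausdorff => A B pA qB.
- have /(_ (A `*` setT) (B `*` setT)) := clpq.
  case.
  + by exists (A, setT) => //=; split=> //; exact: filterT.
  + by exists (B, setT) => //=; split=> //; exact: filterT.
  + by move=> [x y] [[/= Ax _] [/= Bx _]]; exists x.
- have /(_ (setT `*` A) (setT `*` B)) := clpq.
  case.
  + by exists (setT, A) => //=; split=> //; exact: filterT.
  + by exists (setT, B) => //=; split=> //; exact: filterT.
  + by move=> [x y] [[/= _ Ay] [/= _ By]]; exists y.
Qed.

Let openX (A : set M1) (B : set M2) : open A -> open B -> open (A `*` B).
Proof.
rewrite !openE => oA oB [x y] [/= Ax By].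
by exists (A, B) => //=; split; [exact: oA|exact: oB].
Qed.

Let pt_second_countable : @second_countable T.
Proof.
have [B1 cB1 [oB1 bB1]] := @pt_second_countable _ _ M1.
have [B2 cB2 [oB2 bB2]] := @pt_second_countable _ _ M2.
exists ((fun p : set M1 * set M2 => p.1 `*` p.2) @` (B1 `*` B2)).
  apply: (card_le_trans (card_image_le _ _)); exact: countableX.
split=> [_ [[U V] [/= BU BV] <-]|]; first exact: openX (oB1 _ BU) (oB2 _ BV).
move=> [x y] C [[P Q] [/= xP yQ] PQC].
have [U [BU Ux] UP] := bB1 x P xP.
have [V [BV Vy] VQ] := bB2 y Q yQ.
exists (U `*` V); first by split=> //; exists (U, V).
by move=> [z w] [/= Uz Vw]; apply: PQC; split; [exact: UP|exact: VQ].
Qed.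

Let dom_cover (x : T) : exists i, pdom i x.
Proof.
have [[i ix] [j jx]] := (dom_cover x.1, dom_cover x.2).
by exists (i, j); split.
Qed.

Let dom_open (i : I) : open (pdom i).
Proof. by apply: openX; exact: dom_open. Qed.

Let img_setX (i : I) (A : set M1) (B : set M2) :
  pcrd i @` (A `*` B) =
  (lsubmx : 'rV[R]_(n1 + n2) -> 'rV[R]_n1) @^-1` (crd i.1 @` A) `&`
  (rsubmx : 'rV[R]_(n1 + n2) -> 'rV[R]_n2) @^-1` (crd i.2 @` B).
Proof.
apply/seteqP; split=> [_ [[x y] [/= Ax By] <-]|u [[x Ax xu] [y By yu]]].
  split; rewrite /pcrd /=; first by rewrite row_mxKl; exists x.
  by rewrite row_mxKr; exists y.
by exists (x, y); rewrite /pcrd /= ?xu ?yu ?hsubmxK.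
Qed.

Let img_open (i : I) : open (pcrd i @` pdom i).
Proof.
rewrite img_setX; apply: openI; apply: open_comp; try exact: img_open.
  by move=> u _; exact: continuous_lsubmx.
by move=> u _; exact: continuous_rsubmx.
Qed.

Let crdK (i : I) (x : T) : pdom i x -> ppar i (pcrd i x) = x.
Proof.
case: x => x y [/= ix iy].
by rewrite /ppar /pcrd row_mxKl row_mxKr !crdK.
Qed.

Let crd_continuous (i : I) (x : T) :
  pdom i x -> {for x, continuous (pcrd i)}.
Proof.
case: x => x y [/= ix iy].
apply: (@continuous_comp _ _ _ (fun z : T => (crd i.1 z.1, crd i.2 z.2))
  (fun w => row_mx w.1 w.2)); last exact: row_mx_continuous.
apply: (@cvg_pair _ _ _ _ (nbhs (crd i.1 x)) (nbhs (crd i.2 y))) => /=.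
  by apply: (@cvg_comp _ _ _ fst (crd i.1) _ (nbhs x));
    [exact: cvg_fst|exact: crd_continuous].
by apply: (@cvg_comp _ _ _ snd (crd i.2) _ (nbhs y));
  [exact: cvg_snd|exact: crd_continuous].
Qed.

Let par_continuous (i : I) (x : T) :
  pdom i x -> {for pcrd i x, continuous (ppar i)}.
Proof.
case: x => x y [/= ix iy].
have Ex : (par i.1 \o lsubmx) @ pcrd i (x, y) -->
    par i.1 (lsubmx (pcrd i (x, y))).
  apply: continuous_comp; first exact: continuous_lsubmx.
  by rewrite /pcrd row_mxKl; exact: par_continuous.
have Ey : (par i.2 \o rsubmx) @ pcrd i (x, y) -->
    par i.2 (rsubmx (pcrd i (x, y))).
  apply: continuous_comp; first exact: continuous_rsubmx.
  by rewrite /pcrd row_mxKr; exact: par_continuous.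
exact: cvg_pair Ex Ey.
Qed.

Let crd_smooth (i j : I) :
  smooth_on (pcrd i @` (pdom i `&` pdom j)) (pcrd j \o ppar i).
Proof.
have -> : pdom i `&` pdom j = (dom i.1 `&` dom j.1) `*` (dom i.2 `&` dom j.2).
  by rewrite /pdom setXI.
rewrite img_setX.
have -> : pcrd j \o ppar i =
    prod_map (crd j.1 \o par i.1) (crd j.2 \o par i.2) by [].
exact: (prod_map_smooth (@transition_open _ _ M1 i.1 j.1)
  (@transition_open _ _ M2 i.2 j.2)
  (@crd_smooth _ _ M1 i.1 j.1) (@crd_smooth _ _ M2 i.2 j.2)).
Qed.

Definition prod_manifold : manifold R (n1 + n2) :=
  @Manifold R (n1 + n2) T I pdom pcrd ppar pt_hausdorff pt_second_countable
    dom_cover dom_open img_open crdK crd_continuous par_continuous crd_smooth.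

Variables (g1 : tensor2 M1) (g2 : tensor2 M2).

(* g1 + g2 and g1 - k g2, pulled back to the product *)
Definition prod_metric : tensor2 prod_manifold := fun i u =>
  block_mx (g1 i.1 (lsubmx u)) 0 0 (g2 i.2 (rsubmx u)).

Definition warped_metric (k : M1 -> R) : tensor2 prod_manifold := fun i u =>
  block_mx (g1 i.1 (lsubmx u)) 0
    0 (- k (par i.1 (lsubmx u)) *: g2 i.2 (rsubmx u)).

End product_manifold.

(* Derivative at t of a function restricted to J : set R, hence one-sided at
   the end points when J is a closed interval. *)
Section curves.
Variables (R : realType) (V : normedModType R).

Definition diff_quotient (f : R -> V) (t s : R) : V :=
  (s - t)^-1 *: (f s - f t).

Definition deriv_in (J : set R) (f : R -> V) (t : R) : V :=
  lim (diff_quotient f t s @[s --> within J t^']).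

Definition derivable_in (J : set R) (f : R -> V) (t : R) : Prop :=
  cvg (diff_quotient f t s @[s --> within J t^']).

Definition smooth_in (J : set R) (f : R -> V) : Prop :=
  forall m t, J t -> derivable_in J (iter m (deriv_in J) f) t.

End curves.

Section geodesics.
Variables (R : realType) (n : nat) (M : manifold R n).

(* The part of J on which the curve c lies in the domain of the chart i. *)
Definition inside (J : set R) (c : R -> M) (i : idx M) : set R :=
  J `&` c @^-1` dom i.

Definition smooth_curve (J : set R) (c : R -> M) : Prop :=
  {within J, continuous c} /\
  forall i, smooth_in (inside J c i) (crd i \o c).

Definition has_velocity (J : set R) (c : R -> M) (t : R) (x : M)
    (X : tangent x) : Prop :=
  c t = x /\
  forall i, dom i x -> deriv_in (inside J c i) (crd i \o c) t = X i.

(* c'' ^a + Gamma^a_{bc} c' ^b c' ^c = 0 in every chart *)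
Definition geodesic (g : tensor2 M) (J : set R) (c : R -> M) : Prop :=
  smooth_curve J c /\
  forall i t, inside J c i t ->
    let D := deriv_in (inside J c i) in
    let u := crd i \o c in
    forall a : 'I_n,
      D (D u) t 0 a +
      \sum_(b < n) \sum_(d < n)
        christoffel g i (u t) a b d * D u t 0 b * D u t 0 d = 0.

(* Geodesic completeness; equivalent to metric completeness by Hopf-Rinow
   when g is Riemannian and M is connected. *)
Definition complete_metric (g : tensor2 M) : Prop :=
  forall (x : M) (X : tangent x), exists c : R -> M,
    geodesic g setT c /\ has_velocity setT c 0 X.

End geodesics.

Definition unit_itv {R : realType} : set R := `[0, 1]%classic.

Section reparametrization.
Variable R : realType.

Definition diffeo (J : set R) (p : R -> R) : Prop :=
  exists q : R -> R,
    [/\ forall t, J t -> J (p t) /\ q (p t) = t,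
        forall t, J t -> J (q t) /\ p (q t) = t,
        smooth_in J (p : R -> R^o) & smooth_in J (q : R -> R^o)].

Variables (n : nat) (M : manifold R n) (k : M -> R).

(* [sup] and [inf] are 0 on sets without a supremum (resp. infimum), so that
   0 < inf (range k) forces range k to be nonempty and bounded below. *)
Definition k1 : R :=
  if `[< has_ubound (range k) >] then - (sup (range k))^-1 else 0.

Definition a_const (r : R) (mu : R -> M) : R :=
  (\int[lebesgue_measure]_(xi in unit_itv)
     (k (mu xi) / (1 + r * k (mu xi))))%R.

Definition b_const (gam : R -> M) : R :=
  ((\int[lebesgue_measure]_(xi in unit_itv) (k (gam xi))^-1)%R)^-1.

Definition phi_reparam (r : R) (mu : R -> M) (phi : R -> R) : Prop :=
  [/\ diffeo unit_itv phi, phi 0 = 0, phi 1 = 1 &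
      forall t, unit_itv t ->
        deriv_in unit_itv (phi : R -> R^o) t =
        a_const r mu * ((1 + r * k (mu (phi t))) / k (mu (phi t)))].

Definition psi_reparam (gam : R -> M) (psi : R -> R) : Prop :=
  [/\ diffeo unit_itv psi, psi 0 = 0, psi 1 = 1 &
      forall t, unit_itv t ->
        deriv_in unit_itv (psi : R -> R^o) t = b_const gam / k (gam t)].

End reparametrization.

(* Main.v *)
Require Import Defs.
From mathcomp Require Import all_boot all_order all_algebra.
From mathcomp Require Import all_classical all_reals all_analysis.
From mathcomp Require Import ring.

(** Why the theorem is true.

   Everything rests on writing the geodesic equation of a metric g, along a
   curve u in coordinates, in Euler-Lagrange form:
     d/dt (momentum) = force,   momentum = u' g(u)^T,
     force_l = 1/2 d_l [g](u', u'),
   which is equivalent to the Christoffel form as soon as g(u) is invertible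
   ([geodesic_eqP]).  In this form no Christoffel symbol of a product has to be
   computed: for a block metric A(x) + h(x) B(y) the equation splits into
     (x' A^T)' = force_A + 1/2 B(y', y') grad h,   (h y' B^T)' = h force_B
   ([euler_lagrange_warped]).  With h = 1 this says that mu is a geodesic of
   G = f g1, f = 1/k + r, and nu a geodesic of g2; with h = - k it is the
   system that (gam, tau) has to satisfy.

   The reparametrizations are exactly those that turn momenta into constant
   multiples of momenta.  As phi' = a f(gam), the g1-momentum of gam is a times
   the G-momentum of mu at phi; as psi' = b / k(gam), - k times the g2-momentum
   of tau is - b times the g2-momentum of nu at psi.  Differentiating these
   identities once more with the chain rule, the equation for tau comes out at
   once, and the one for gam does up to the gradient terms: there one finds
     a^2/2 f g1(mu', mu') grad f = - a^2/2 G(mu', mu') grad k / k^2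
   where - 1/2 g2(tau', tau') grad k = - b^2/2 g2(nu', nu') grad k / k^2 is
   wanted.  Both squared speeds G(mu', mu') and g2(nu', nu') are constant along
   geodesics ([sq_speed_const]), so that the two terms agree for all times
   because they agree at time 0, which is the assumption on X0 and Y0.

   The bulk of the work is the calculus of one-sided derivatives on relatively
   open parts of [0, 1], which is where a curve lies in a given chart. *)

Set Implicit Arguments.
Unset Strict Implicit.
Unset Printing Implicit Defensive.

Import Order.TTheory GRing.Theory Num.Theory.
Import numFieldNormedType.Exports.

Local Open Scope classical_set_scope.
Local Open Scope ring_scope.

(** * One-sided derivatives *)

(** Caratheodory's form of differentiability relative to J: the slope q extends
   continuously to t with value l.  Unlike a statement on difference quotients
   it makes sense at the point t itself, which turns the product and chain
   rules into algebraic identities; and, as a relation, it passes to subsets of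
   J without any hypothesis on limit points. *)
Definition has_deriv (R : realType) (V : normedModType R) (J : set R)
    (f : R -> V) (t : R) (l : V) : Prop :=
  exists q : R -> V, [/\ q t = l,
    forall s, J s -> f s - f t = (s - t) *: q s &
    q s @[s --> within J (nbhs t)] --> l].

Section calculus.
Variable R : realType.
Implicit Types (V W : normedModType R) (J : set R) (t : R).

Lemma has_derivP V J (f : R -> V) t l :
  has_deriv J f t l <-> diff_quotient f t s @[s --> within J t^'] --> l.
Proof.
split=> [[q [_ fq ql]]|fl].
  have ql' : q s @[s --> within J t^'] --> l.
    move=> A Al; have H : nbhs t [set s | J s -> A (q s)] := ql A Al.
    have {}H : nbhs t [set s | s != t -> J s -> A (q s)].
      by apply: filterS H => s H _; exact: H.
    exact: H.
  apply: cvg_trans ql'; apply: near_eq_cvg.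
  have H : nbhs t [set s | s != t -> J s -> q s = diff_quotient f t s].
    apply: filterE => s st Js; rewrite /diff_quotient fq// scalerA.
    by rewrite mulVf ?scale1r// subr_eq0.
  exact: H.
exists (fun s => if s == t then l else diff_quotient f t s); split.
- by rewrite eqxx.
- move=> s Js; case: eqVneq => [->|st]; first by rewrite !subrr scale0r.
  by rewrite scalerA mulfV ?scale1r// subr_eq0.
move=> A Al; have H : nbhs t [set s | s != t -> J s -> A (diff_quotient f t s)].
  exact: fl A Al.
suff : nbhs t [set s | J s ->
    A (if s == t then l else diff_quotient f t s)] by [].
apply: filterS H => s /= H Js.
by case: eqVneq => [_|st]; [exact: nbhs_singleton|exact: H].
Qed.

Lemma has_deriv_sub V J J' (f : R -> V) t l :
  J' `<=` J -> has_deriv J f t l -> has_deriv J' f t l.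
Proof.
move=> JJ [q [qt fq ql]]; exists q; split=> // [s /JJ/fq //|].
by apply: cvg_trans ql; apply: cvg_app; exact: within_subset.
Qed.

(** The derivative at t only sees J near t: this is how derivatives are moved
   between the domains of different charts. *)
Lemma has_deriv_near V J J' (f g : R -> V) t l :
  (\forall s \near t, J' s -> J s) -> {in J', f =1 g} -> J' t ->
  has_deriv J f t l -> has_deriv J' g t l.
Proof.
move=> JJ fg J't [q [qt fq ql]].
exists (fun s => if s == t then l else diff_quotient g t s); split.
- by rewrite eqxx.
- move=> s Js; case: eqVneq => [->|st]; first by rewrite !subrr scale0r.
  by rewrite scalerA mulfV ?scale1r// subr_eq0.
move=> A Al; have H : nbhs t [set s | J s -> A (q s)] := ql A Al.
suff : nbhs t [set s | J' s ->
    A (if s == t then l else diff_quotient g t s)] by [].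
apply: filterS2 JJ H => s /= JJs H J's.
case: eqVneq => [_|st]; first exact: nbhs_singleton.
rewrite /diff_quotient -!fg ?inE// fq; last exact: JJs.
by rewrite scalerA mulVf ?scale1r ?subr_eq0//; apply/H/JJs.
Qed.

Lemma has_deriv_eq V J (f g : R -> V) t l :
  {in J, f =1 g} -> J t -> has_deriv J f t l -> has_deriv J g t l.
Proof. by move=> fg Jt; apply: has_deriv_near => //; exact: filterE. Qed.

Lemma has_deriv_cont V J (f : R -> V) t l :
  has_deriv J f t l -> f s @[s --> within J (nbhs t)] --> f t.
Proof.
move=> [q [qt fq ql]].
have E : f t + (s - t) *: q s @[s --> within J (nbhs t)] --> f t.
  rewrite -[X in _ --> X]addr0 -[X in _ --> _ + X](scale0r l) -(subrr t).
  apply: cvgD; first exact: cvg_cst.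
  apply: cvgZ => //; apply: cvgB; last exact: cvg_cst.
  exact: cvg_within.
apply: cvg_trans E; apply: near_eq_cvg.
have H : nbhs t [set s | J s -> f t + (s - t) *: q s = f s].
  by apply: filterE => s Js; rewrite -fq// addrC subrK.
exact: H.
Qed.

(** Derivatives are unique only where t is not isolated in J; the hypothesis on
   the filter says this. *)
Lemma has_deriv_unique V J (f : R -> V) t l l' :
  ProperFilter (within J t^') ->
  has_deriv J f t l -> has_deriv J f t l' -> l = l'.
Proof. by move=> pf /has_derivP fl /has_derivP; exact: cvg_unique. Qed.

Lemma deriv_inE V J (f : R -> V) t l :
  ProperFilter (within J t^') -> has_deriv J f t l -> deriv_in J f t = l.
Proof. by move=> pf /has_derivP; exact: cvg_lim. Qed.

Lemma derivable_inP V J (f : R -> V) t :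
  derivable_in J f t -> has_deriv J f t (deriv_in J f t).
Proof. by move=> cf; exact/has_derivP. Qed.

Lemma has_deriv_cst V J (c : V) t : has_deriv J (fun=> c) t 0.
Proof.
exists (fun=> 0); split=> // [s _|]; first by rewrite subrr scaler0.
exact: cvg_cst.
Qed.

Lemma has_derivD V J (f g : R -> V) t l m :
  has_deriv J f t l -> has_deriv J g t m ->
  has_deriv J (fun s => f s + g s) t (l + m).
Proof.
move=> [p [pt fp pl]] [q [qt gq qm]].
exists (fun s => p s + q s); split; first by rewrite pt qt.
  by move=> s Js; rewrite opprD addrACA fp// gq// scalerDr.
exact: cvgD.
Qed.

Lemma has_deriv_sum V J (I : Type) (r : seq I) (f : I -> R -> V) t
    (l : I -> V) :
  (forall i, has_deriv J (f i) t (l i)) ->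
  has_deriv J (fun s => \sum_(i <- r) f i s) t (\sum_(i <- r) l i).
Proof.
move=> fl; elim: r => [|i r IH].
  under eq_fun do rewrite big_nil.
  by rewrite big_nil; exact: has_deriv_cst.
under eq_fun do rewrite big_cons.
by rewrite big_cons; exact: has_derivD.
Qed.

Lemma has_derivZ V J (a : R -> R^o) (f : R -> V) t a' l :
  has_deriv J a t a' -> has_deriv J f t l ->
  has_deriv J (fun s => a s *: f s) t (a' *: f t + a t *: l).
Proof.
move=> [p [pt ap pa]] df; have cf := has_deriv_cont df.
case: df => [q [qt fq ql]].
exists (fun s => p s *: f s + a t *: q s); split; first by rewrite pt qt.
  move=> s Js; rewrite scalerDr scalerA [_ * p s](_ : _ = a s - a t); last first.
    by rewrite ap.
  rewrite [_ *: (a t *: _)]scalerA mulrC -scalerA -fq//.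
  by rewrite scalerBl scalerBr addrA subrK.
apply: cvgD; first exact: cvgZ.
by apply: cvgZ => //; exact: cvg_cst.
Qed.

Lemma has_derivZl V J (c : R) (f : R -> V) t l :
  has_deriv J f t l -> has_deriv J (fun s => c *: f s) t (c *: l).
Proof.
move=> df; have := has_derivZ (has_deriv_cst J (c : R^o) t) df.
by rewrite scale0r add0r.
Qed.

(** Since the slope of f is defined at p t too, it does not matter whether p
   takes the value p t at points other than t. *)
Lemma has_deriv_comp V J J' (f : R -> V) (p : R -> R^o) t l p' :
  (forall s, J s -> J' (p s)) ->
  has_deriv J' f (p t) l -> has_deriv J p t p' ->
  has_deriv J (f \o p) t (p' *: l).
Proof.
move=> JJ [q [qt fq ql]] dp; have cp := has_deriv_cont dp.
case: dp => [h [ht ph hp]].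
exists (fun s => h s *: q (p s)); split; first by rewrite ht qt.
  move=> s Js; rewrite /= fq; last exact: JJ.
  by rewrite scalerA; congr (_ *: _); exact: ph.
apply: cvgZ => // A Al.
have B : nbhs (p t) [set y | J' y -> A (q y)] := ql A Al.
have {}B : nbhs t [set s | J s -> J' (p s) -> A (q (p s))] := cp _ B.
suff : nbhs t [set s | J s -> A (q (p s))] by [].
by apply: filterS B => s /= B Js; apply: B => //; exact: JJ.
Qed.

(** The remainder of h at u t, divided by s - t, is small because u s - u t is
   (s - t) times a slope that stays bounded near t. *)
Lemma has_deriv_diff V W J (h : V -> W) (u : R -> V) t v :
  differentiable h (u t) -> has_deriv J u t v ->
  has_deriv J (h \o u) t ('d h (u t) v).
Proof.
move=> dh du; have cu := has_deriv_cont du; case: du => [q [qt uq qv]].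
have [cdh /eqaddoP Eh] := iffLR (diff_locallyP _ _) dh.
pose rem s := h (u s) - h (u t) - 'd h (u t) (u s - u t).
exists (fun s => 'd h (u t) (q s) + (s - t)^-1 *: rem s); split.
- by rewrite subrr invr0 scale0r addr0 qt.
- move=> s Js; rewrite scalerDr scalerA.
  have [->|st] := eqVneq s t; first by rewrite !subrr mul0r !scale0r addr0.
  by rewrite mulfV ?subr_eq0// scale1r /rem uq// linearZ /= [RHS]addrC subrK.
rewrite -[X in _ --> X]addr0; apply: cvgD.
  by apply: continuous_cvg => //; exact: cdh.
apply/cvgr0Pnorm_le => e e0.
(* The slope q tends to v, so N bounds it near t. *)
pose N := `|v| + 1.
have N0 : 0 < N by rewrite ltr_wpDl.
have qN : \forall s \near within J (nbhs t), `|q s| <= N.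
  by apply: (cvgr_norm_le v) => //; rewrite ltrDl.
have uE : \forall s \near within J (nbhs t), `|rem s| <= e / N * `|u s - u t|.
  have cu0 : u s - u t @[s --> within J (nbhs t)] --> (0 : V).
    by rewrite -(subrr (u t)); apply: cvgB => //; exact: cvg_cst.
  have H : \forall s \near within J (nbhs t),
      `|(h \o shift (u t) - (cst (h (u t)) + 'd h (u t))) (u s - u t)|
        <= e / N * `|u s - u t| := cu0 _ (Eh (e / N) (divr_gt0 e0 N0)).
  apply: filterS H => s /=.
  by rewrite !fctE /= subrK opprD addrA.
have JT : \forall s \near within J (nbhs t), J s by exact: withinT.
apply: filterS3 qN uE JT => s qN uE Js.
have [->|st] := eqVneq s t; first by rewrite subrr invr0 scale0r normr0 ltW.
have st0 : 0 < `|s - t| by rewrite normr_gt0 subr_eq0.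
rewrite normrZ normfV -ler_pdivlMl ?invr_gt0// invrK.
apply: (le_trans uE); rewrite uq// normrZ mulrCA ler_pM2l//.
by rewrite mulrAC ler_pdivrMr// ler_pM2l.
Qed.

End calculus.

Section components.
Variable R : realType.
Implicit Types (J : set R) (t : R).

Lemma has_derivM J (a b : R -> R^o) t a' b' :
  has_deriv J a t a' -> has_deriv J b t b' ->
  has_deriv J (fun s => a s * b s : R^o) t (a' * b t + a t * b').
Proof. exact: (@has_derivZ R R^o). Qed.

Lemma has_deriv_row n J (f : R -> 'rV[R]_n) t l :
  has_deriv J f t l <->
  forall a, has_deriv J (fun s => f s 0 a : R^o) t (l 0 a).
Proof.
split=> [[q [qt fq ql]] a|fl].
  exists (fun s => q s 0 a); split=> [|s Js|]; first by rewrite qt.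
    by have /rowP/(_ a) := fq s Js; rewrite !mxE.
  have ca : {for l, continuous (fun w : 'rV[R]_n => w 0 a)}.
    exact: coord_continuous.
  exact: cvg_comp ql ca.
apply/has_derivP/cvg_ballP => e e0.
have H : \forall s \near within J t^', forall a : 'I_n,
    ball (l 0 a) e (diff_quotient f t s 0 a).
  apply: filter_forall => a.
  have /has_derivP/cvg_ballP/(_ e e0) := fl a.
  apply: filterS => s; rewrite /diff_quotient !mxE.
  by [].
by apply: filterS H => s H; split=> // i j; rewrite (ord1 i).
Qed.

Lemma has_deriv_row_mx n1 n2 J (f : R -> 'rV[R]_n1) (g : R -> 'rV[R]_n2)
    t l m :
  has_deriv J (fun s => row_mx (f s) (g s)) t (row_mx l m) <->
  has_deriv J f t l /\ has_deriv J g t m.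
Proof.
split=> [/has_deriv_row H|[/has_deriv_row fl /has_deriv_row gm]].
  split; apply/has_deriv_row => a.
    have := H (lshift n2 a); rewrite row_mxEl.
    by under eq_fun do rewrite row_mxEl.
  have := H (rshift n1 a); rewrite row_mxEr.
  by under eq_fun do rewrite row_mxEr.
apply/has_deriv_row => a; case: (split_ordP a) => b ->.
  by under eq_fun do rewrite row_mxEl; rewrite row_mxEl.
by under eq_fun do rewrite row_mxEr; rewrite row_mxEr.
Qed.

End components.

(** * Smoothness on relatively open parts of an interval *)

Section smoothness.
Variable R : realType.
Implicit Types (V : normedModType R) (J : set R) (t : R).

(** Existence of m successive derivatives on J, with the derivatives chosen
   freely rather than computed as limits: the product and chain rules are then
   proved by induction on m, and restriction to a subset is immediate. *)
Fixpoint cdiff V (m : nat) J (f : R -> V) : Prop :=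
  if m is m'.+1 then exists f' : R -> V,
    (forall t, J t -> has_deriv J f t (f' t)) /\ cdiff m' J f'
  else True.

Definition perfect J := forall t, J t -> ProperFilter (within J t^').

Lemma smooth_in_cdiff V J (f : R -> V) : smooth_in J f -> forall m, cdiff m J f.
Proof.
move=> sf m; elim: m f sf => [//|m IH] f sf.
exists (deriv_in J f); split=> [t Jt|]; first exact/derivable_inP/(sf 0).
by apply: IH => j t Jt; rewrite -iterSr; exact: sf.
Qed.

Lemma eq_cdiff V m J (f g : R -> V) :
  {in J, f =1 g} -> cdiff m J f -> cdiff m J g.
Proof.
case: m => [//|m] fg [f' [ff' cf']]; exists f'; split=> // t Jt.
by apply: has_deriv_eq fg _ _ => //; exact: ff'.
Qed.

Lemma cdiff_smooth_in V J (f : R -> V) :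
  perfect J -> (forall m, cdiff m J f) -> smooth_in J f.
Proof.
move=> pJ cf m; have := cf m.+1; elim: m f {cf} => [|m IH] f [f' [ff' cf']] t Jt.
  by apply/cvg_ex; exists (f' t); apply/has_derivP; exact: ff'.
rewrite iterSr; apply: IH => //; apply: (@eq_cdiff _ m.+1 _ f') => // s.
rewrite inE => Js.
by apply/esym/deriv_inE; [exact: pJ|exact: ff'].
Qed.

Lemma cdiff_sub V m J J' (f : R -> V) : J' `<=` J -> cdiff m J f -> cdiff m J' f.
Proof.
move=> JJ; elim: m f => [//|m IH] f [f' [ff' cf']]; exists f'.
split; last exact: IH.
by move=> t J't; apply: has_deriv_sub (ff' _ _) => //; exact: JJ.
Qed.

Lemma cdiffW V m J (f : R -> V) : cdiff m.+1 J f -> cdiff m J f.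
Proof.
elim: m f => [//|m IH] f [f' [ff' cf']]; exists f'; split=> //; exact: IH.
Qed.

Lemma cdiffD V m J (f g : R -> V) :
  cdiff m J f -> cdiff m J g -> cdiff m J (fun s => f s + g s).
Proof.
elim: m f g => [//|m IH] f g [f' [ff' cf']] [g' [gg' cg']].
exists (fun s => f' s + g' s); split; last exact: IH.
by move=> t Jt; apply: has_derivD; [exact: ff'|exact: gg'].
Qed.

Lemma cdiffZ V m J (a : R -> R^o) (f : R -> V) :
  cdiff m J a -> cdiff m J f -> cdiff m J (fun s => a s *: f s).
Proof.
elim: m a f => [//|m IH] a f ca cf.
have [[a' [aa' ca']] [f' [ff' cf']]] := (ca, cf).
exists (fun s => a' s *: f s + a s *: f' s); split.
  by move=> t Jt; apply: has_derivZ; [exact: aa'|exact: ff'].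
by apply: cdiffD; apply: IH => //; exact: cdiffW.
Qed.

Lemma cdiff_comp V m J J' (f : R -> V) (p : R -> R^o) :
  (forall s, J s -> J' (p s)) ->
  cdiff m J' f -> cdiff m J p -> cdiff m J (f \o p).
Proof.
move=> JJ; elim: m f => [//|m IH] f [f' [ff' cf']] cp.
have [p' [pp' cp']] := cp.
exists (fun s => p' s *: (f' \o p) s); split.
  move=> t Jt; apply: (has_deriv_comp JJ); [exact/ff'/JJ|exact: pp'].
by apply: cdiffZ => //; apply: IH => //; exact: cdiffW.
Qed.

Lemma cdiff_row_mx n1 n2 m J (f : R -> 'rV[R]_n1) (g : R -> 'rV[R]_n2) :
  cdiff m J (fun s => row_mx (f s) (g s)) <-> cdiff m J f /\ cdiff m J g.
Proof.
elim: m f g => [//|m IH] f g; split.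
  move=> [h [fgh ch]].
  have ch' : cdiff m J (fun s => row_mx (lsubmx (h s)) (rsubmx (h s))).
    by apply: eq_cdiff ch => s _; rewrite hsubmxK.
  have [c1 c2] := iffLR (IH _ _) ch'.
  have H t : J t -> has_deriv J f t (lsubmx (h t)) /\
                    has_deriv J g t (rsubmx (h t)).
    by move=> Jt; apply/has_deriv_row_mx; rewrite hsubmxK; exact: fgh.
  split; [exists (lsubmx \o h)|exists (rsubmx \o h)];
    by split=> // t /H[].
move=> [[f' [ff' cf']] [g' [gg' cg']]].
exists (fun s => row_mx (f' s) (g' s)); split; last exact/IH.
by move=> t Jt; apply/has_deriv_row_mx; split; [exact: ff'|exact: gg'].
Qed.

Lemma within_dnbhs_eq J J' t :
  J' `<=` J -> (\forall s \near t, J s -> J' s) ->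
  within J t^' = within J' t^'.
Proof.
move=> JJ nJ; apply/seteqP; split=> A.
  exact: within_subset.
move=> A' ; have H : nbhs t [set s | s != t -> J' s -> A s] := A'.
have {}H : nbhs t [set s | s != t -> J s -> A s].
  by apply: filterS2 nJ H => s JJ's H st /JJ's; exact: H.
exact: H.
Qed.

Lemma eq_diff_quotient V J (f g : R -> V) t :
  {in J, f =1 g} -> J t ->
  diff_quotient f t s @[s --> within J t^'] =
  diff_quotient g t s @[s --> within J t^'].
Proof.
move=> fg Jt.
have H (f1 g1 : R -> V) : {in J, f1 =1 g1} ->
    \forall s \near within J t^', diff_quotient f1 t s = diff_quotient g1 t s.
  move=> fg1; have JT : \forall s \near within J t^', J s by exact: withinT.
  by apply: filterS JT => s Js; rewrite /diff_quotient !fg1// inE.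
by apply/seteqP; split; apply: near_eq_cvg; apply: H => // s /fg/esym.
Qed.

(** If J' is relatively open in J, the filters of punctured neighbourhoods in J
   and J' coincide at the points of J', hence so do all iterated derivatives,
   whatever the convention on limits that do not exist. *)
Lemma iter_deriv_in V m J J' (f : R -> V) :
  J' `<=` J -> (forall t, J' t -> \forall s \near t, J s -> J' s) ->
  {in J', iter m (deriv_in J) f =1 iter m (deriv_in J') f}.
Proof.
move=> JJ nJ; elim: m => [//|m IH] t; rewrite inE => J't /=.
rewrite {1}/deriv_in (within_dnbhs_eq JJ (nJ _ J't)).
by rewrite (eq_diff_quotient IH).
Qed.

Lemma smooth_in_local V J (f : R -> V) :
  (forall t, J t -> exists J', [/\ J' `<=` J, J' t,
     forall s, J' s -> \forall x \near s, J x -> J' x & smooth_in J' f]) ->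
  smooth_in J f.
Proof.
move=> H m t /H[J' [JJ J't nJ sf]].
rewrite /derivable_in (within_dnbhs_eq JJ (nJ _ J't)).
by rewrite (eq_diff_quotient (iter_deriv_in _ _ JJ nJ))//; exact: sf.
Qed.

(** A point of [0, 1] is approached from the right if it lies in the left half
   and from the left otherwise. *)
Lemma relatively_open_perfect J :
  J `<=` unit_itv -> (forall t, J t -> \forall s \near t, unit_itv s -> J s) ->
  perfect J.
Proof.
move=> JI nJ t Jt; rewrite -(within_dnbhs_eq JI (nJ t Jt)).
have : unit_itv t by exact: JI.
rewrite /unit_itv /= in_itv /= => /andP[t0 t1].
apply: Build_ProperFilter_ex => A.
move=> A'; have [e /= e0 H] : nbhs t [set s | s != t -> unit_itv s -> A s] := A'.
(* A step d < e stays in the given ball, and d <= 1/2 keeps it in [0, 1]. *)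
pose d := Num.min (e / 2) (1 / 2).
have d0 : 0 < d by rewrite lt_min !divr_gt0.
have de : d < e.
  by rewrite gt_min ltr_pdivrMr// ltr_pMr// ltr1n.
have d1 : d <= 1 / 2 by rewrite ge_min lexx orbT.
have [t2|t2] := leP t (1 / 2).
  exists (t + d); apply: H => /=.
  - by rewrite opprD addrA subrr sub0r normrN gtr0_norm.
  - by rewrite -subr_eq0 addrAC subrr add0r gt_eqF.
  rewrite /unit_itv /= in_itv /=; apply/andP; split.
    by rewrite addr_ge0// ltW.
  by rewrite [X in _ <= X](splitr 1) lerD.
exists (t - d); apply: H => /=.
- by rewrite opprB addrCA subrr addr0 gtr0_norm.
- by rewrite -subr_eq0 addrAC subrr add0r oppr_eq0 gt_eqF.
rewrite /unit_itv /= in_itv /= subr_ge0 (le_trans d1 (ltW t2))/=.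
by rewrite (le_trans _ t1)// gerBl ltW.
Qed.

End smoothness.

(** * Geodesics in Euler-Lagrange form *)

Section coordinates.
Variables (R : realType) (n : nat).
Implicit Types (g : 'rV[R]_n -> 'M[R]_n) (u v w : 'rV[R]_n) (J : set R).

Definition quad (G : 'M[R]_n) (v : 'rV[R]_n) : R := (v *m G *m v^T) 0 0.

(** The covector g(., v) for v the velocity; the transpose lets the index of the
   covector be the first one of g, as in the Christoffel symbols. *)
Definition momentum g (u v : R -> 'rV[R]_n) (s : R) : 'rV[R]_n :=
  v s *m (g (u s))^T.

(** The covector of the partial derivatives of g(v, v) / 2 in the base point, the
   velocity v being fixed. *)
Definition force g u v : 'rV[R]_n :=
  \row_l (2^-1 * partial l (fun w => quad (g w) v) u).

Definition diff_entries g u : Prop :=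
  forall a b, differentiable (fun w => g w a b : R^o) u.

Lemma quadE (G : 'M[R]_n) v :
  quad G v = \sum_b \sum_d v 0 b * v 0 d * G b d.
Proof.
rewrite /quad mxE exchange_big /=; apply: eq_bigr => d _.
rewrite !mxE big_distrl /=; apply: eq_bigr => b _.
by rewrite -!mulrA [G _ _ * _]mulrC.
Qed.

Lemma quadZ (G : 'M[R]_n) (c : R) v : quad G (c *: v) = c ^+ 2 * quad G v.
Proof.
by rewrite /quad linearZ /= -scalemxAr -!scalemxAl !mxE mulrA expr2.
Qed.

Lemma scale_quad (G : 'M[R]_n) (c : R) v : quad (c *: G) v = c * quad G v.
Proof. by rewrite /quad -scalemxAr -scalemxAl mxE. Qed.

Lemma diff_partial (h : 'rV[R]_n -> R^o) u v :
  differentiable h u -> 'd h u v = \sum_b v 0 b * partial b h u.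
Proof.
move=> dh; rewrite {1}(row_sum_delta v) linear_sum; apply: eq_bigr => b _.
by rewrite linearZ /= /partial deriveE.
Qed.

Lemma differentiable_quad g u v : diff_entries g u ->
  differentiable (fun w => quad (g w) v : R^o) u.
Proof.
move=> dg.
have -> : (fun w => quad (g w) v : R^o) =
    \sum_b \sum_d (v 0 b * v 0 d) *: (fun w => g w b d : R^o).
  apply/funext => w; rewrite quadE fct_sumE; apply: eq_bigr => b _.
  by rewrite fct_sumE.
by do 2 (apply: differentiable_sum => ?); exact: differentiableZ.
Qed.

Lemma partial_quad g u v l : diff_entries g u ->
  partial l (fun w => quad (g w) v) u =
  \sum_b \sum_d v 0 b * v 0 d * partial l (fun w => g w b d) u.
Proof.
move=> dg; rewrite /partial.
have -> : (fun w => quad (g w) v : R^o) =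
    \sum_b \sum_d (v 0 b * v 0 d) *: (fun w => g w b d : R^o).
  apply/funext => w; rewrite quadE fct_sumE; apply: eq_bigr => b _.
  by rewrite fct_sumE.
have dgd b d : derivable (fun w => g w b d : R^o) u (delta_mx 0 l).
  exact: diff_derivable.
rewrite derive_sum; last by move=> b; apply: derivable_sum => d; exact: derivableZ.
apply: eq_bigr => b _; rewrite derive_sum; last by move=> d; exact: derivableZ.
by apply: eq_bigr => d _; rewrite deriveZ.
Qed.

Lemma momentum_deriv g J (u v : R -> 'rV[R]_n) t w :
  diff_entries g (u t) -> has_deriv J u t (v t) -> has_deriv J v t w ->
  has_deriv J (momentum g u v) t
    (w *m (g (u t))^T + \row_l \sum_b \sum_d
       v t 0 b * v t 0 d * partial b (fun x => g x l d) (u t)).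
Proof.
move=> dg du /has_deriv_row dv; apply/has_deriv_row => l.
have -> : (fun s => momentum g u v s 0 l : R^o) =
    (fun s => \sum_d v s 0 d * g (u s) l d).
  apply/funext => s; rewrite mxE; apply: eq_bigr => d _.
  by rewrite mxE.
rewrite !mxE exchange_big -big_split /=; apply: has_deriv_sum => d.
rewrite mxE.
have -> : \sum_b v t 0 b * v t 0 d * partial b (fun x => g x l d) (u t) =
    v t 0 d * 'd (fun x => g x l d : R^o) (u t) (v t).
  rewrite diff_partial// mulr_sumr; apply: eq_bigr => b _.
  by rewrite mulrCA mulrA.
apply: has_derivM; first exact: dv.
exact: (@has_deriv_diff _ _ R^o _ (fun x => g x l d) u).
Qed.

(** Summed against v_b v_d, the first two terms of a Christoffel symbol become
   equal by exchanging b and d; together they give the derivative of g along v,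
   and the third term gives the force. *)
Lemma christoffel_sum (M : manifold R n) (g : tensor2 M) (i : idx M) u v a :
  diff_entries (g i) u ->
  \sum_b \sum_d christoffel g i u a b d * v 0 b * v 0 d =
  (invmx (g i u) *m ((\row_l \sum_b \sum_d
       v 0 b * v 0 d * partial b (fun x => g i x l d) u) - force (g i) u v)^T)
    a 0.
Proof.
move=> dg; rewrite !mxE.
transitivity (\sum_l invmx (g i u) a l * (2^-1 * \sum_b \sum_d v 0 b * v 0 d *
  (partial b (fun w => g i w l d) u + partial d (fun w => g i w l b) u
   - partial l (fun w => g i w b d) u))).
  transitivity (\sum_b \sum_l \sum_d invmx (g i u) a l *
    (2^-1 * (v 0 b * v 0 d *
  (partial b (fun w => g i w l d) u + partial d (fun w => g i w l b) u
   - partial l (fun w => g i w b d) u)))).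
    apply: eq_bigr => b _; rewrite exchange_big /=; apply: eq_bigr => d _.
    rewrite /christoffel -!mulrA mulr_suml mulr_sumr; apply: eq_bigr => l _.
    by ring.
  rewrite exchange_big /=; apply: eq_bigr => l _.
  rewrite !mulr_sumr; apply: eq_bigr => b _.
  by rewrite !mulr_sumr.
apply: eq_bigr => l _; congr (_ * _); rewrite !mxE partial_quad//.
have E : \sum_b \sum_d v 0 b * v 0 d * partial d (fun w => g i w l b) u =
         \sum_b \sum_d v 0 b * v 0 d * partial b (fun w => g i w l d) u.
  rewrite exchange_big; apply: eq_bigr => b _; apply: eq_bigr => d _.
  by rewrite [v 0 d * _]mulrC.
set P := (X in _ = X - _); set Q := (X in _ = _ - _ * X).
have {}E : \sum_b \sum_d v 0 b * v 0 d * partial d (fun w => g i w l b) u = P.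
  exact: E.
transitivity (2^-1 * (P + P - Q)).
  congr (_ * _); rewrite -{2}E -!sumrN -!big_split; apply: eq_bigr => b _ /=.
  rewrite -sumrN -!big_split; apply: eq_bigr => d _ /=.
  by rewrite mulrBr mulrDr.
by field.
Qed.

(** Multiplying the geodesic equation by g(u) lowers its index; what remains of
   the Christoffel terms is the part of the derivative of the momentum that
   comes from the variation of g, minus the force. *)
Lemma geodesic_eqP (M : manifold R n) (g : tensor2 M) (i : idx M) J
    (u v : R -> 'rV[R]_n) t w :
  diff_entries (g i) (u t) -> g i (u t) \in unitmx ->
  ProperFilter (within J t^') ->
  has_deriv J u t (v t) -> has_deriv J v t w ->
  (forall a, w 0 a + \sum_b \sum_d
      christoffel g i (u t) a b d * v t 0 b * v t 0 d = 0) <->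
  has_deriv J (momentum (g i) u v) t (force (g i) (u t) (v t)).
Proof.
move=> dg ug pf du dv; have H := momentum_deriv dg du dv.
set P := (X in _ + X) in H.
have E : (forall a, w 0 a + \sum_b \sum_d
      christoffel g i (u t) a b d * v t 0 b * v t 0 d = 0) <->
    w *m (g i (u t))^T + P = force (g i) (u t) (v t).
  transitivity (w^T + invmx (g i (u t)) *m (P - force (g i) (u t) (v t))^T = 0).
    split=> [H1|/colP H1 a]; last first.
      by rewrite christoffel_sum//; have := H1 a; rewrite !mxE.
    by apply/colP => a; have := H1 a; rewrite christoffel_sum// !mxE.
  split=> [/(congr1 (mulmx (g i (u t))))|H1].
    rewrite mulmxDr mulmx0 mulKVmx// => /(congr1 trmx).
    rewrite trmx0 linearD /= trmxK trmx_mul trmxK addrA => /eqP.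
    by rewrite subr_eq0 => /eqP.
  apply: (can_inj (mulKmx ug)); rewrite mulmx0 mulmxDr mulKVmx//.
  apply: (can_inj trmxK); rewrite trmx0 linearD /= trmxK trmx_mul trmxK addrA.
  by rewrite H1 subrr.
split=> [/E <- //|H1]; apply/E; exact: has_deriv_unique H H1.
Qed.

(** Let S be the derivative of g along v, evaluated on (v, v).  The pairing of
   the force with v is S / 2 by definition, and by the Euler-Lagrange equation
   it is g(v', v) + S, whence g(v', v) = - S / 2.  The derivative of the pairing
   of v with the momentum is g(v', v) plus the pairing of v with the force,
   that is - S / 2 + S / 2. *)
Lemma quad_deriv0 g J (u v : R -> 'rV[R]_n) t w :
  diff_entries g (u t) -> (g (u t))^T = g (u t) ->
  ProperFilter (within J t^') ->
  has_deriv J u t (v t) -> has_deriv J v t w ->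
  has_deriv J (momentum g u v) t (force g (u t) (v t)) ->
  has_deriv J (fun s => quad (g (u s)) (v s) : R^o) t 0.
Proof.
move=> dg sg pf du dv dp; have dp' := momentum_deriv dg du dv.
have E := has_deriv_unique pf dp' dp.
have -> : (fun s => quad (g (u s)) (v s) : R^o) =
    (fun s => \sum_l v s 0 l * momentum g u v s 0 l).
  apply/funext => s; rewrite /quad -mulmxA mxE; apply: eq_bigr => l _.
  congr (_ * _); rewrite /momentum !mxE.
  by apply: eq_bigr => d _; rewrite !mxE mulrC.
have D : has_deriv J (fun s => \sum_l v s 0 l * momentum g u v s 0 l : R^o) t
    (\sum_l (w 0 l * momentum g u v t 0 l +
             v t 0 l * force g (u t) (v t) 0 l)).
  apply: has_deriv_sum => l; apply: has_derivM.
    by move/has_deriv_row: dv.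
  by move/has_deriv_row: dp.
suff E0 : \sum_l (w 0 l * momentum g u v t 0 l +
    v t 0 l * force g (u t) (v t) 0 l) = 0 by move: D; rewrite E0.
have dot (a b : 'rV[R]_n) : \sum_l a 0 l * b 0 l = (a *m b^T) 0 0.
  by rewrite mxE; apply: eq_bigr => l _; rewrite mxE.
rewrite big_split /= !dot.
set P := (X in _ + X) in E.
pose S := \sum_l \sum_b \sum_d
  v t 0 l * v t 0 b * v t 0 d * partial l (fun x => g x b d) (u t).
have F_S : (v t *m (force g (u t) (v t))^T) 0 0 = 2^-1 * S.
  rewrite -dot mulr_sumr; apply: eq_bigr => l _.
  rewrite mxE partial_quad// mulrCA; congr (_ * _).
  rewrite mulr_sumr; apply: eq_bigr => b _.
  by rewrite mulr_sumr; apply: eq_bigr => d _; rewrite !mulrA.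
have P_S : (v t *m P^T) 0 0 = S.
  rewrite -dot /S exchange_big; apply: eq_bigr => l _ /=.
  rewrite mxE mulr_sumr; apply: eq_bigr => b _.
  rewrite mulr_sumr; apply: eq_bigr => d _.
  by rewrite !mulrA [v t 0 l * _]mulrC.
have W : (w *m (momentum g u v t)^T) 0 0 = (v t *m (w *m (g (u t))^T)^T) 0 0.
  have tr00 (A : 'M[R]_1) : A 0 0 = A^T 0 0 by rewrite mxE.
  by rewrite [RHS]tr00 /momentum !sg !trmx_mul !trmxK !sg mulmxA.
have : (v t *m (w *m (g (u t))^T + P)^T) 0 0 = 2^-1 * S by rewrite E.
rewrite linearD /= mulmxDr mxE P_S -W F_S => H.
have -> : (w *m (momentum g u v t)^T) 0 0 = 2^-1 * S - S.
  by rewrite -H addrK.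
by field.
Qed.
End coordinates.

(** * Scaled and warped metrics in coordinates *)

Section scaled.
Variables (R : realType) (n : nat).
Implicit Types (g : 'rV[R]_n -> 'M[R]_n) (f : 'rV[R]_n -> R^o) (u v : 'rV[R]_n).

Definition grad f u : 'rV[R]_n := \row_l partial l f u.

Lemma partialD (l : 'I_n) f f' u : differentiable f u -> differentiable f' u ->
  partial l (fun w => f w + f' w) u = partial l f u + partial l f' u.
Proof. by move=> df df'; apply: deriveD; exact: diff_derivable. Qed.

Lemma partialM (l : 'I_n) f f' u : differentiable f u -> differentiable f' u ->
  partial l (fun w => f w * f' w) u = f u * partial l f' u + f' u * partial l f u.
Proof. by move=> df df'; apply: deriveM; exact: diff_derivable. Qed.

Lemma partial_cst (l : 'I_n) (c : R) u : partial l (fun=> c) u = 0.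
Proof. exact: derive_cst. Qed.

Lemma diff_entries_scale f g u : differentiable f u -> diff_entries g u ->
  diff_entries (fun w => f w *: g w) u.
Proof.
move=> df dg a b; under eq_fun do rewrite mxE.
exact: differentiableM.
Qed.

(** The conformal factor acts on the force through its own gradient as well. *)
Lemma force_scale f g u v : differentiable f u -> diff_entries g u ->
  force (fun w => f w *: g w) u v =
  f u *: force g u v + (2^-1 * quad (g u) v) *: grad f u.
Proof.
move=> df dg; apply/rowP => l; rewrite !mxE.
under [X in partial _ X _]eq_fun do rewrite scale_quad.
rewrite partialM//; last exact: differentiable_quad.
by rewrite mulrDr [2^-1 * (f u * _)]mulrCA -[2^-1 * quad _ _ * _]mulrA.
Qed.

Lemma forceZ g u v (c : R) : diff_entries g u ->
  force g u (c *: v) = c ^+ 2 *: force g u v.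
Proof.
move=> dg; apply/rowP => l; rewrite !mxE.
under [X in partial _ X _]eq_fun do rewrite quadZ.
rewrite partialM//; last exact: differentiable_quad.
by rewrite partial_cst mulr0 addr0 mulrCA.
Qed.

End scaled.

Section block.
Variables (R : realType) (n1 n2 : nat).
Variables (A : 'rV[R]_n1 -> 'M[R]_n1) (B : 'rV[R]_n2 -> 'M[R]_n2).
Variable h : 'rV[R]_n1 -> R^o.
Implicit Types (x : 'rV[R]_n1) (y : 'rV[R]_n2).

Definition warped (u : 'rV[R]_(n1 + n2)) : 'M[R]_(n1 + n2) :=
  block_mx (A (lsubmx u)) 0 0 (h (lsubmx u) *: B (rsubmx u)).

Lemma differentiable_lsubmx (V : normedModType R) (f : 'rV[R]_n1 -> V) (u : 'rV[R]_(n1 + n2)) :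
  differentiable f (lsubmx u) -> differentiable (fun w => f (lsubmx w)) u.
Proof.
move=> df; have [] := @diff_sandwich R _ _ _ _ idfun lsubmx f u => //.
  by move=> z; exact: cvg_id.
exact: continuous_lsubmx.
Qed.

Lemma differentiable_rsubmx (V : normedModType R) (f : 'rV[R]_n2 -> V) (u : 'rV[R]_(n1 + n2)) :
  differentiable f (rsubmx u) -> differentiable (fun w => f (rsubmx w)) u.
Proof.
move=> df; have [] := @diff_sandwich R _ _ _ _ idfun rsubmx f u => //.
  by move=> z; exact: cvg_id.
exact: continuous_rsubmx.
Qed.

Lemma diff_entries_warped u : diff_entries A (lsubmx u) ->
  diff_entries B (rsubmx u) -> differentiable h (lsubmx u) ->
  diff_entries warped u.
Proof.
move=> dA dB dh a b; rewrite /warped.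
case: (split_ordP a) => a' ->; case: (split_ordP b) => b' ->.
- under eq_fun do rewrite block_mxEul.
  exact: (differentiable_lsubmx (f := fun w => A w a' b' : R^o)).
- under eq_fun do rewrite block_mxEur mxE.
  exact: differentiable_cst.
- under eq_fun do rewrite block_mxEdl mxE.
  exact: differentiable_cst.
- under eq_fun do rewrite block_mxEdr mxE.
  apply: differentiableM; first exact: differentiable_lsubmx.
  exact: (differentiable_rsubmx (f := fun w => B w a' b' : R^o)).
Qed.

Lemma unit_warped u : A (lsubmx u) \in unitmx -> B (rsubmx u) \in unitmx ->
  h (lsubmx u) != 0 -> warped u \in unitmx.
Proof.
rewrite !unitmxE => uA uB h0; rewrite /warped det_ublock detZ.
by rewrite unitrM uA unitrM uB andbT unitrX// unitfE.
Qed.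

Lemma momentum_warped (x vx : R -> 'rV[R]_n1) (y vy : R -> 'rV[R]_n2) s :
  momentum warped (fun s => row_mx (x s) (y s))
    (fun s => row_mx (vx s) (vy s)) s =
  row_mx (momentum A x vx s) (h (x s) *: momentum B y vy s).
Proof.
rewrite /momentum /warped row_mxKl row_mxKr tr_block_mx mul_row_block.
by rewrite !trmx0 !mulmx0 addr0 add0r linearZ /= -scalemxAr.
Qed.

Lemma quad_warped x y vx vy :
  quad (warped (row_mx x y)) (row_mx vx vy) =
  quad (A x) vx + h x * quad (B y) vy.
Proof.
rewrite /quad /warped row_mxKl row_mxKr mul_row_block tr_row_mx mul_row_col.
rewrite !mulmx0 addr0 add0r [(_ + _ : matrix _ _ _) 0 0]mxE -scalemxAr -scalemxAl.
by rewrite [(_ *: _ : matrix _ _ _) 0 0]mxE.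
Qed.

(** The difference quotients of the two sides are equal, so that this holds even
   where they have no limit. *)
Lemma partial_lshift (F : 'rV[R]_(n1 + n2) -> R^o) x y l :
  partial (lshift n2 l) F (row_mx x y) = partial l (fun z => F (row_mx z y)) x.
Proof.
have E (e : R) : e *: delta_mx 0 (lshift n2 l) + row_mx x y =
    row_mx (e *: delta_mx 0 l + x) y.
  have -> : delta_mx 0 (lshift n2 l) = row_mx (delta_mx 0 l) 0 :> 'rV[R]__.
    apply/rowP => a; case: (split_ordP a) => b ->.
      by rewrite row_mxEl !mxE (inj_eq (@lshift_inj _ _)).
    by rewrite row_mxEr !mxE eq_rlshift andbF.
  by rewrite scale_row_mx add_row_mx scaler0 add0r.
rewrite /partial /derive.
by under eq_fun do rewrite /= E.
Qed.

Lemma partial_rshift (F : 'rV[R]_(n1 + n2) -> R^o) x y l :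
  partial (rshift n1 l) F (row_mx x y) = partial l (fun z => F (row_mx x z)) y.
Proof.
have E (e : R) : e *: delta_mx 0 (rshift n1 l) + row_mx x y =
    row_mx x (e *: delta_mx 0 l + y).
  have -> : delta_mx 0 (rshift n1 l) = row_mx 0 (delta_mx 0 l) :> 'rV[R]__.
    apply/rowP => a; case: (split_ordP a) => b ->.
      by rewrite row_mxEl !mxE eq_lrshift andbF.
    by rewrite row_mxEr !mxE (inj_eq (@rshift_inj _ _)).
  by rewrite scale_row_mx add_row_mx scaler0 add0r.
rewrite /partial /derive.
by under eq_fun do rewrite /= E.
Qed.

Lemma force_warped x y vx vy :
  diff_entries A x -> diff_entries B y -> differentiable h x ->
  force warped (row_mx x y) (row_mx vx vy) =
  row_mx (force A x vx + (2^-1 * quad (B y) vy) *: grad h x)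
         (h x *: force B y vy).
Proof.
move=> dA dB dh; apply/rowP => a; rewrite mxE.
case: (split_ordP a) => l ->.
  rewrite row_mxEl partial_lshift.
  under [X in partial _ X _]eq_fun do rewrite quad_warped.
  rewrite partialD; first last.
  - exact: differentiableM.
  - exact: differentiable_quad.
  rewrite partialM//.
  by rewrite partial_cst mulr0 add0r !mxE mulrDr mulrA.
rewrite row_mxEr partial_rshift.
under [X in partial _ X _]eq_fun do rewrite quad_warped.
rewrite partialD; first last.
- apply: differentiableM; last exact: differentiable_quad.
  exact: (differentiable_cst (h x : R^o)).
- exact: (differentiable_cst (quad (A x) vx : R^o)).
rewrite partial_cst add0r partialM; first last.
- exact: differentiable_quad.
- exact: (differentiable_cst (h x : R^o)).
by rewrite partial_cst mulr0 addr0 !mxE mulrCA.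
Qed.

End block.

(** * Functions with zero derivative *)

Section constancy.
Variable R : realType.

Lemma has_deriv_is_derive (f : R -> R^o) t l :
  has_deriv setT f t l -> is_derive t 1 f l.
Proof.
move=> df.
have ds : has_deriv setT (fun e : R => e + t : R^o) 0 1.
  exists (fun=> 1); split=> //; last exact: cvg_cst.
  by move=> s _; rewrite add0r addrK subr0 [RHS]mulr1.
have df' : has_deriv setT f (0 + t) l by rewrite add0r.
have /has_derivP H := @has_deriv_comp _ _ setT setT f (fun e => e + t) 0 l 1
  (fun s _ => Logic.I) df' ds.
have {}H : e^-1 *: ((f \o shift t) (e *: 1) - f t) @[e --> 0^'] --> l.
  rewrite scale1r in H; move=> A Al.
  have H1 : nbhs 0 [set e : R | e != 0 -> setT e -> A (diff_quotient (f \o (fun e => e + t)) 0 e)].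
    exact: H A Al.
  have {}H1 : nbhs 0 [set e : R | e != 0 -> A (e^-1 *: ((f \o shift t) (e *: 1) - f t))].
    apply: filterS H1 => e He e0; have := He e0 Logic.I.
    by rewrite /diff_quotient /= subr0 add0r [e *: _]mulr1.
  exact: H1.
split; last exact: cvg_lim H.
by apply/cvg_ex; exists l.
Qed.

Lemma has_deriv0_cst (f : R -> R^o) :
  (forall t, unit_itv t -> has_deriv unit_itv f t 0) ->
  forall t, unit_itv t -> f t = f 0.
Proof.
move=> df t It; have := It; rewrite /unit_itv /= in_itv /= => /andP[t0 t1].
have [||c _ ] := @MVT_segment R f (fun=> 0) 0 t t0.
- move=> x; rewrite in_itv /= => /andP[x0 xt]; apply: has_deriv_is_derive.
  have Ix : x \in `]0, 1[ by rewrite in_itv /= x0 (lt_le_trans xt t1).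
  apply: has_deriv_near (df x _) => //.
    have := near_in_itvoo Ix; apply: filterS => s + _.
    by rewrite !in_itv /= => /andP[s0 s1]; rewrite /unit_itv /= in_itv /= !ltW.
  by rewrite /unit_itv /= in_itv /= !ltW ?(lt_le_trans xt t1).
- apply: (@continuous_subspaceW _ _ _ unit_itv).
    move=> s; rewrite /unit_itv /= !in_itv /= => /andP[-> st] /=.
    exact: le_trans t1.
  by apply/subspace_continuousP => x Ix; exact: has_deriv_cont (df x Ix).
by rewrite mul0r => /eqP; rewrite subr_eq0 => /eqP.
Qed.

End constancy.

(** * Curves in a manifold and conservation of speed *)

Section curves.
Variables (R : realType) (n : nat) (M : manifold R n).
Implicit Types (c : R -> M) (i j : idx M) (g : tensor2 M).

Local Notation I := (@unit_itv R).

Definition velocity c i : R -> 'rV[R]_n := deriv_in (inside I c i) (crd i \o c).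

Lemma inside_near c i t : {within I, continuous c} -> inside I c i t ->
  \forall s \near t, I s -> inside I c i s.
Proof.
move=> /subspace_continuousP cc [It ict].
have H : nbhs t [set s | I s -> dom i (c s)].
  by apply: (cc t It); apply: open_nbhs_nbhs; split=> //; exact: dom_open.
by apply: filterS H => s H Is; split=> //; exact: H.
Qed.

Lemma inside_perfect c i : {within I, continuous c} -> perfect (inside I c i).
Proof.
move=> cc; apply: relatively_open_perfect => [s []//|t it]; exact: inside_near.
Qed.

Lemma velocityP c i t : smooth_curve I c -> inside I c i t ->
  has_deriv (inside I c i) (crd i \o c) t (velocity c i t).
Proof. by move=> [_ sc] it; exact/derivable_inP/(sc i 0). Qed.

Lemma accelerationP c i t : smooth_curve I c -> inside I c i t ->
  has_deriv (inside I c i) (velocity c i) t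
    (deriv_in (inside I c i) (velocity c i) t).
Proof. by move=> [_ sc] it; exact/derivable_inP/(sc i 1%N). Qed.

Lemma velocityE c i t J v : {within I, continuous c} -> inside I c i t ->
  J t -> (\forall s \near t, I s -> J s) ->
  has_deriv J (crd i \o c) t v -> velocity c i t = v.
Proof.
move=> cc it Jt nJ dv; apply: deriv_inE; first exact: inside_perfect.
by apply: has_deriv_near dv => //; apply: filterS nJ => s H [/H].
Qed.

(** The chain rule for the change of coordinates; it makes the squared speed
   independent of the chart. *)
Lemma velocity_change c i j t : smooth_curve I c ->
  inside I c i t -> inside I c j t ->
  velocity c j t = velocity c i t *m 'J (crd j \o par i) (crd i (c t)).
Proof.
move=> sc it jt; have [cc _] := sc.
rewrite /jacobian mul_rV_lin1 /=.
apply: (@velocityE _ _ _ (inside I c i `&` inside I c j)) => //.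
  apply: filterS2 (inside_near cc it) (inside_near cc jt) => s Hi Hj Is.
  by split; [exact: Hi|exact: Hj].
have dt : differentiable (crd j \o par i) (crd i (c t)).
  apply: (@crd_smooth _ _ M i j [::]); exists (c t) => //.
  by split; [exact: (proj2 it)|exact: (proj2 jt)].
have H := has_deriv_diff dt (velocityP sc it).
apply: (@has_deriv_near _ _ (inside I c i)) H => //.
  by apply: filterE => s [].
move=> s; rewrite inE => -[[_ /= ics] _] /=.
by rewrite crdK.
Qed.

Definition euler_lagrange g c := forall i t, inside I c i t ->
  has_deriv (inside I c i) (momentum (g i) (crd i \o c) (velocity c i)) t
    (force (g i) (crd i (c t)) (velocity c i t)).

(** The properties on which the equivalence of the two forms of the geodesic
   equation rests; the indefinite warped metric shares them with the Riemannian
   ones. *)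
Definition regular_metric g := forall i x, dom i x ->
  diff_entries (g i) (crd i x) /\ g i (crd i x) \in unitmx.

Lemma geodesicP g c : regular_metric g ->
  geodesic g I c <-> smooth_curve I c /\ euler_lagrange g c.
Proof.
move=> rg; suff H : smooth_curve I c -> (forall i t, inside I c i t ->
    let D := deriv_in (inside I c i) in
    let u := crd i \o c in
    forall a : 'I_n,
      D (D u) t 0 a +
      \sum_(b < n) \sum_(d < n)
        christoffel g i (u t) a b d * D u t 0 b * D u t 0 d = 0) <->
    euler_lagrange g c.
  by split=> -[sc /(H sc)].
move=> sc; have [cc _] := sc.
have E i t (it : inside I c i t) := geodesic_eqP
  (proj1 (rg _ _ (proj2 it))) (proj2 (rg _ _ (proj2 it)))
  (inside_perfect cc it) (velocityP sc it) (accelerationP sc it).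
by split=> H i t it; apply/(E i t it); exact: H.
Qed.

Definition tensor_law g := forall i j x, dom i x -> dom j x ->
  let J := 'J (crd j \o par i) (crd i x) in
  g i (crd i x) = J *m g j (crd j x) *m J^T.

Definition symmetric_tensor g := forall i x, dom i x ->
  (g i (crd i x))^T = g i (crd i x).

Definition sq_speed g c i t : R := quad (g i (crd i (c t))) (velocity c i t).

Lemma sq_speed_chart g c i j t : tensor_law g -> smooth_curve I c ->
  inside I c i t -> inside I c j t -> sq_speed g c i t = sq_speed g c j t.
Proof.
move=> tg sc it jt; rewrite /sq_speed (velocity_change sc it jt) /quad.
by rewrite (tg i j _ (proj2 it) (proj2 jt)) trmx_mul !mulmxA.
Qed.

(** The squared speed has derivative zero in every chart.  Charts are patched
   together by reading it, at each time, in the chart chosen at that point. *)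
Lemma sq_speed_const g c i j t :
  tensor_law g -> symmetric_tensor g -> regular_metric g ->
  smooth_curve I c -> euler_lagrange g c ->
  inside I c i t -> inside I c j 0 -> sq_speed g c i t = sq_speed g c j 0.
Proof.
move=> tg sg rg sc ELc it j0; have [cc _] := sc.
pose e s := sq_speed g c (chart_at (c s)) s.
have chartP x : dom (chart_at x) x by exact: projT2 (cid (dom_cover x)).
have eE k s : inside I c k s -> sq_speed g c k s = e s.
  move=> ks; apply: sq_speed_chart => //.
  by split; [exact: (proj1 ks)|exact: chartP].
rewrite !eE//; apply: (has_deriv0_cst (f := e)) => [s Is|]; last exact: (proj1 it).
have ks : inside I c (chart_at (c s)) s by split=> //; exact: chartP.
have [dg _] := rg _ _ (proj2 ks).
have H := quad_deriv0 dg (sg _ _ (proj2 ks)) (inside_perfect cc ks)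
  (velocityP sc ks) (accelerationP sc ks) (ELc _ _ ks).
have {}H : has_deriv (inside I c (chart_at (c s))) e s 0.
  by apply: has_deriv_eq H => // z; rewrite inE => kz; exact: eE.
by apply: has_deriv_near H => //; exact: inside_near.
Qed.

End curves.

(** * Curves in a product manifold *)

Section product.
Variables (R : realType) (n1 n2 : nat).
Variables (M1 : manifold R n1) (M2 : manifold R n2).
Variables (mu : R -> M1) (nu : R -> M2).

Local Notation I := (@unit_itv R).

Definition pair_curve (t : R) : prod_manifold M1 M2 := (mu t, nu t).

Lemma inside_pair i1 i2 t : inside I pair_curve (i1, i2) t <->
  inside I mu i1 t /\ inside I nu i2 t.
Proof. by split=> [[It [m1 m2]]|[[It m1] [_ m2]]]; split. Qed.

Lemma continuous_pair : {within I, continuous pair_curve} <->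
  {within I, continuous mu} /\ {within I, continuous nu}.
Proof.
split=> [/subspace_continuousP cc|[/subspace_continuousP c1
    /subspace_continuousP c2]].
  split; apply/subspace_continuousP => t It.
    exact: (cvg_comp _ _ (cc t It) (@cvg_fst M1 M2 _ _ _)).
  exact: (cvg_comp _ _ (cc t It) (@cvg_snd M1 M2 _ _ _)).
by apply/subspace_continuousP => t It; exact: cvg_pair (c1 t It) (c2 t It).
Qed.

(** A chart of one factor alone is completed, near each given time, by some chart
   of the other factor around the point reached there. *)
Lemma smooth_curve_pair : smooth_curve I pair_curve <->
  smooth_curve I mu /\ smooth_curve I nu.
Proof.
split=> [[cc sc]|[[c1 s1] [c2 s2]]].
  have [c1 c2] := iffLR continuous_pair cc.
  have split12 i1 i2 : smooth_in (inside I pair_curve (i1, i2)) (crd i1 \o mu) /\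
                       smooth_in (inside I pair_curve (i1, i2)) (crd i2 \o nu).
    have cd m := iffLR (@cdiff_row_mx _ _ _ m (inside I pair_curve (i1, i2))
      (crd i1 \o mu) (crd i2 \o nu)) (smooth_in_cdiff (sc (i1, i2)) m).
    by split; apply: cdiff_smooth_in (inside_perfect cc) _ => m; have [] := cd m.
  split; split=> // i; apply: smooth_in_local => t it.
    have [i2 it2] := dom_cover (nu t).
    exists (inside I pair_curve (i, i2)); split.
    - by move=> s /inside_pair[].
    - by apply/inside_pair; split=> //; split=> //; exact: (proj1 it).
    - move=> s /(inside_near cc); apply: filterS => x Hx [Ix _]; exact: Hx.
    - exact: (proj1 (split12 _ _)).
  have [i1 it1] := dom_cover (mu t).
  exists (inside I pair_curve (i1, i)); split.
  - by move=> s /inside_pair[].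
  - by apply/inside_pair; split=> //; split=> //; exact: (proj1 it).
  - move=> s /(inside_near cc); apply: filterS => x Hx [Ix _]; exact: Hx.
  - exact: (proj2 (split12 _ _)).
have cc := iffRL continuous_pair (conj c1 c2).
split=> // -[i1 i2]; apply: cdiff_smooth_in (inside_perfect cc) _ => m.
apply: (iffRL (@cdiff_row_mx _ _ _ m _ (crd i1 \o mu) (crd i2 \o nu))).
split.
  apply: (@cdiff_sub _ _ _ (inside I mu i1)); last exact: smooth_in_cdiff.
  by move=> s /inside_pair[].
apply: (@cdiff_sub _ _ _ (inside I nu i2)); last exact: smooth_in_cdiff.
by move=> s /inside_pair[].
Qed.

Lemma velocity_pair i1 i2 t : smooth_curve I mu -> smooth_curve I nu ->
  inside I pair_curve (i1, i2) t ->
  velocity pair_curve (i1, i2) t = row_mx (velocity mu i1 t) (velocity nu i2 t).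
Proof.
move=> s1 s2 it; have /smooth_curve_pair[cc _] := conj s1 s2.
apply: (velocityE cc it it (inside_near cc it)).
apply: (iffRL (@has_deriv_row_mx _ _ _ _ (crd i1 \o mu) (crd i2 \o nu) _ _ _)).
have [it1 it2] := iffLR (inside_pair _ _ _) it.
split.
  by apply: has_deriv_sub (velocityP s1 it1) => s /inside_pair[].
by apply: has_deriv_sub (velocityP s2 it2) => s /inside_pair[].
Qed.

Variables (g1 : tensor2 M1) (g2 : tensor2 M2) (h : M1 -> R).
Variable g : tensor2 (prod_manifold M1 M2).
Hypothesis gE : forall i, g i = warped (g1 i.1) (g2 i.2) (h \o par i.1).
Hypothesis reg1 : regular_metric g1.
Hypothesis reg2 : regular_metric g2.
Hypothesis dh : forall i x, dom i x ->
  differentiable (h \o par i : _ -> R^o) (crd i x).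
Hypothesis h0 : forall x, h x != 0.

Lemma regular_warped : regular_metric g.
Proof.
move=> [i1 i2] [x y] [/= i1x i2y]; rewrite gE /=.
have [[dg1 u1] [dg2 u2]] := (reg1 i1x, reg2 i2y).
split; [apply: diff_entries_warped|apply: unit_warped];
  rewrite ?row_mxKl ?row_mxKr//.
  exact: dh.
exact: h0.
Qed.

(** Read block by block, momentum and force of A(x) + h(x) B(y) give one equation
   for each factor: the dependence of h on x adds a gradient term to the force
   on the first, and weights the momentum on the second. *)
Lemma euler_lagrange_warped : smooth_curve I mu -> smooth_curve I nu ->
  euler_lagrange g pair_curve <->
  forall i1 i2 t, inside I pair_curve (i1, i2) t ->
    let J := inside I pair_curve (i1, i2) in
    let x := crd i1 \o mu in let y := crd i2 \o nu in
    let vx := velocity mu i1 in let vy := velocity nu i2 in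
    has_deriv J (momentum (g1 i1) x vx) t
      (force (g1 i1) (x t) (vx t) +
       (2^-1 * quad (g2 i2 (y t)) (vy t)) *: grad (h \o par i1) (x t)) /\
    has_deriv J (fun s => h (mu s) *: momentum (g2 i2) y vy s) t
      (h (mu t) *: force (g2 i2) (y t) (vy t)).
Proof.
move=> s1 s2; have HE i1 i2 t (it : inside I pair_curve (i1, i2) t) :
    has_deriv (inside I pair_curve (i1, i2)) (momentum (g (i1, i2))
      (crd (m := prod_manifold M1 M2) (i1, i2) \o pair_curve) (velocity pair_curve (i1, i2))) t
      (force (g (i1, i2)) (crd (m := prod_manifold M1 M2) (i1, i2) (pair_curve t))
        (velocity pair_curve (i1, i2) t)) <->
    let J := inside I pair_curve (i1, i2) in
    let x := crd i1 \o mu in let y := crd i2 \o nu in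
    let vx := velocity mu i1 in let vy := velocity nu i2 in
    has_deriv J (momentum (g1 i1) x vx) t
      (force (g1 i1) (x t) (vx t) +
       (2^-1 * quad (g2 i2 (y t)) (vy t)) *: grad (h \o par i1) (x t)) /\
    has_deriv J (fun s => h (mu s) *: momentum (g2 i2) y vy s) t
      (h (mu t) *: force (g2 i2) (y t) (vy t)).
  pose J := inside I pair_curve (i1, i2).
  pose x := crd i1 \o mu; pose y := crd i2 \o nu.
  pose vx := velocity mu i1; pose vy := velocity nu i2.
  rewrite gE [(i1, i2).1]/= [(i1, i2).2]/= (velocity_pair s1 s2 it).
  have [it1 it2] := iffLR (inside_pair _ _ _) it.
  have -> : force (warped (g1 i1) (g2 i2) (h \o par i1))
      (crd (m := prod_manifold M1 M2) (i1, i2) (pair_curve t)) (row_mx (vx t) (vy t)) =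
    row_mx (force (g1 i1) (x t) (vx t) +
       (2^-1 * quad (g2 i2 (y t)) (vy t)) *: grad (h \o par i1) (x t))
      (h (mu t) *: force (g2 i2) (y t) (vy t)).
    have := @force_warped _ _ _ (g1 i1) (g2 i2) (h \o par i1) (x t) (y t) (vx t) (vy t).
    rewrite /= crdK; last exact: (proj2 it1).
    apply.
    - exact: (proj1 (reg1 (proj2 it1))).
    - exact: (proj1 (reg2 (proj2 it2))).
    - exact: dh (proj2 it1).
  have E : {in J, momentum (warped (g1 i1) (g2 i2) (h \o par i1))
        (crd (m := prod_manifold M1 M2) (i1, i2) \o pair_curve) (velocity pair_curve (i1, i2)) =1
      fun s => row_mx (momentum (g1 i1) x vx s)
        (h (mu s) *: momentum (g2 i2) y vy s)}.
    move=> s; rewrite inE => Js.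
    have [is1 is2] := iffLR (inside_pair _ _ _) Js.
    have := @momentum_warped _ _ _ (g1 i1) (g2 i2) (h \o par i1) x vx y vy s.
    rewrite /= crdK; last exact: (proj2 is1).
    by move=> <-; rewrite /momentum velocity_pair.
  split=> [H|[H1 H2]].
    by apply/has_deriv_row_mx; exact: has_deriv_eq E it H.
  have K := iffRL (has_deriv_row_mx J _ _ t _ _) (conj H1 H2).
  by refine (has_deriv_eq _ it K) => s /E ->.
split=> H.
  by move=> i1 i2 t it; apply/HE => //; exact: H.
by move=> [i1 i2] t it; apply/HE => //; exact: H.
Qed.

End product.

(** * Reparametrized curves *)

Section reparam.
Variables (R : realType) (n : nat) (M : manifold R n).
Variables (c : R -> M) (p : R -> R^o).
Local Notation I := (@unit_itv R).
Hypothesis sc : smooth_curve I c.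
Hypothesis sp : smooth_in I p.
Hypothesis pI : forall t, I t -> I (p t).

Lemma inside_reparam i t : inside I (c \o p) i t -> inside I c i (p t).
Proof. by move=> [It ict]; split; [exact: pI|]. Qed.

(** Continuity of c is relative to the interval, which is why p must map the
   interval to itself. *)
Lemma continuous_reparam : {within I, continuous (c \o p)}.
Proof.
have [/subspace_continuousP cc _] := sc.
apply/subspace_continuousP => t It.
have cp := has_deriv_cont (derivable_inP (@sp 0%N t It)).
move=> A Ac.
have H : nbhs (p t) [set s | I s -> A (c s)] := cc (p t) (pI It) A Ac.
have {}H : nbhs t [set s | I s -> I (p s) -> A (c (p s))] := cp _ H.
suff : nbhs t [set s | I s -> A (c (p s))] by [].
by apply: filterS H => s H Is; apply: H => //; exact: pI.
Qed.

Lemma smooth_curve_reparam : smooth_curve I (c \o p).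
Proof.
split=> [|i]; first exact: continuous_reparam.
apply: cdiff_smooth_in (inside_perfect continuous_reparam) _ => m.
have [_ sci] := sc.
apply: (cdiff_comp (@inside_reparam i) (smooth_in_cdiff (sci i) m)).
by apply: cdiff_sub (smooth_in_cdiff sp m) => s [].
Qed.

Lemma velocity_reparam i t p' : inside I (c \o p) i t -> has_deriv I p t p' ->
  velocity (c \o p) i t = p' *: velocity c i (p t).
Proof.
move=> it dp; have cc := continuous_reparam.
apply: (velocityE cc it it (inside_near cc it)).
apply: (@has_deriv_comp _ _ _ (inside I c i) (crd i \o c) p t _ p' (@inside_reparam i)).
  by apply: velocityP => //; exact: inside_reparam.
by apply: has_deriv_sub dp => s [].
Qed.

Lemma momentum_reparam g i t p' : euler_lagrange g c ->
  inside I (c \o p) i t -> has_deriv I p t p' ->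
  has_deriv (inside I (c \o p) i)
    (momentum (g i) (crd i \o c) (velocity c i) \o p) t
    (p' *: force (g i) (crd i (c (p t))) (velocity c i (p t))).
Proof.
move=> ELc it dp; apply: (has_deriv_comp (@inside_reparam i)).
  by apply: ELc; exact: inside_reparam.
by apply: has_deriv_sub dp => s [].
Qed.

End reparam.

(** * Metrics on a manifold and the warping function *)

Section metrics.
Variables (R : realType) (n : nat) (M : manifold R n).
Implicit Types (g : tensor2 M) (k : M -> R).

(** A vector of the kernel would have length zero. *)
Lemma posdef_unitmx m (G : 'M[R]_m) :
  (forall v : 'rV_m, v != 0 -> 0 < (v *m G *m v^T) 0 0) -> G \in unitmx.
Proof.
move=> pG; rewrite -row_free_unit -kermx_eq0; apply/rowV0P => v /sub_kermxP vG.
by apply/eqP/negPn/negP => /pG; rewrite vG mul0mx mxE ltxx.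
Qed.

Lemma riemannian_regular g : riemannian g -> regular_metric g.
Proof.
move=> [[sg _] _ pg] i x ix; split; last exact/posdef_unitmx/pg.
by move=> a b; apply: (sg i a b [::]); exists x.
Qed.

Lemma smooth_function_diff k i x : smooth_function k -> dom i x ->
  differentiable (k \o par i : _ -> R^o) (crd i x).
Proof. by move=> sk ix; apply: (sk i [::]); exists x. Qed.

Lemma regular_scale f g :
  (forall i x, dom i x -> differentiable (f \o par i : _ -> R^o) (crd i x)) ->
  (forall x, f x != 0) -> regular_metric g -> regular_metric (scale_tensor2 f g).
Proof.
move=> df f0 rg i x ix; have [dg ug] := rg i x ix.
split; first exact: (diff_entries_scale (df i x ix) dg).
rewrite unitmxE in ug; rewrite /scale_tensor2 unitmxE detZ unitrM ug andbT.
by rewrite unitrX // unitfE.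
Qed.

Lemma symmetric_scale f g : symmetric_tensor g ->
  symmetric_tensor (scale_tensor2 f g).
Proof. by move=> sg i x ix; rewrite /scale_tensor2 linearZ /= sg. Qed.

Lemma tensor_law_scale f g : tensor_law g -> tensor_law (scale_tensor2 f g).
Proof.
move=> lg i j x ix jx; rewrite /scale_tensor2 /= !crdK// (lg i j x ix jx).
by rewrite -scalemxAr -scalemxAl.
Qed.

(** By convention the infimum is 0 if the range has no lower bound, so that a
   positive infimum is a true lower bound. *)
Lemma inf_range_gt0 (T : Type) (k : T -> R) x : 0 < inf (range k) -> 0 < k x.
Proof.
move=> k0; apply: (lt_le_trans k0); apply: ge_inf; last by exists x.
have [[]//|] := pselect (has_inf (range k)).
by move=> /inf_out k00; rewrite k00 ltxx in k0.
Qed.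

(** If k is bounded then 1/k >= 1/sup k = - k1, and otherwise k1 = 0 < 1/k. *)
Lemma k1_lt_pos k r x : 0 < inf (range k) -> k1 k < r -> 0 < (k x)^-1 + r.
Proof.
move=> k0; have kp := inf_range_gt0 x k0; rewrite /k1; case: asboolP => ub H.
  have kle : k x <= sup (range k).
    by apply: ub_le_sup => //; exists x.
  rewrite -ltrBlDl sub0r; apply: le_lt_trans H.
  by rewrite lerN2 lef_pV2// posrE// (lt_le_trans kp).
by rewrite addr_gt0// invr_gt0.
Qed.

End metrics.

Section grads.
Variables (R : realType) (n : nat) (k : 'rV[R]_n -> R^o) (u : 'rV[R]_n).
Hypothesis dk : differentiable k u.

Lemma gradN : grad (fun w => - k w) u = - grad k u.
Proof.
apply/rowP => l; rewrite !mxE /partial; apply: deriveN; exact: diff_derivable.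
Qed.

Hypothesis k0 : k u != 0.

Lemma differentiable_invD r : differentiable (fun w => (k w)^-1 + r : R^o) u.
Proof.
apply: differentiableD; last exact: (differentiable_cst (r : R^o)).
exact: differentiableV.
Qed.

Lemma grad_invD r : grad (fun w => (k w)^-1 + r) u = - (k u ^- 2) *: grad k u.
Proof.
apply/rowP => l; rewrite !mxE partialD.
- rewrite partial_cst addr0; apply: deriveV => //; exact: diff_derivable.
- exact: differentiableV.
- exact: (differentiable_cst (r : R^o)).
Qed.
End grads.

(** * From a product geodesic to a warped product geodesic *)

Section split.
Variables (R : realType) (n1 n2 : nat).
Variables (M1 : manifold R n1) (M2 : manifold R n2).
Variables (g1 : tensor2 M1) (g2 : tensor2 M2) (mu : R -> M1) (nu : R -> M2).
Local Notation I := (@unit_itv R).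

Lemma prod_metricE i :
  prod_metric g1 g2 i = warped (g1 i.1) (g2 i.2) ((fun=> 1) \o par i.1).
Proof. by apply/funext => u; rewrite /warped scale1r. Qed.

(** A product is a warped product with constant warping function 1, the gradient
   of which vanishes. *)
Lemma geodesic_prod_split : regular_metric g1 -> regular_metric g2 ->
  geodesic (prod_metric g1 g2) I (pair_curve mu nu) ->
  [/\ smooth_curve I mu, smooth_curve I nu, euler_lagrange g1 mu &
      euler_lagrange g2 nu].
Proof.
move=> r1 r2.
have d1 (i : idx M1) x : dom i x ->
    differentiable ((fun=> 1) \o par i : 'rV[R]_n1 -> R^o) (crd i x).
  by move=> _; exact: (differentiable_cst (1 : R^o)).
have rp := regular_warped prod_metricE r1 r2 d1 (fun=> oner_neq0 R).
move=> /(geodesicP _ rp)[sc ELc].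
have [s1 s2] := iffLR (smooth_curve_pair _ _) sc; have [cc _] := sc.
have ELw := iffLR (euler_lagrange_warped prod_metricE r1 r2 d1 s1 s2) ELc.
split=> // [i1 t it|i2 t it].
  have [i2 it2] := dom_cover (nu t).
  have pt : inside I (pair_curve mu nu) (i1, i2) t.
    by apply/inside_pair; split=> //; split=> //; exact: (proj1 it).
  have [+ _] := ELw i1 i2 t pt.
  rewrite (_ : grad _ _ = 0) ?scaler0 ?addr0 => [H|].
    apply: has_deriv_near H => //; apply: filterS (inside_near cc pt).
    by move=> s Hs [Is _]; exact: Hs.
  by apply/rowP => l; rewrite !mxE; exact: partial_cst.
have [i1 it1] := dom_cover (mu t).
have pt : inside I (pair_curve mu nu) (i1, i2) t.
  by apply/inside_pair; split=> //; split=> //; exact: (proj1 it).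
have [_] := ELw i1 i2 t pt; rewrite scale1r => H.
apply: has_deriv_near H => //.
  apply: filterS (inside_near cc pt).
  by move=> s Hs [Is _]; exact: Hs.
by move=> s _; rewrite scale1r.
Qed.

Lemma warped_metricE (k : M1 -> R) i :
  warped_metric g1 g2 k i = warped (g1 i.1) (g2 i.2) ((fun x => - k x) \o par i.1).
Proof. by []. Qed.

End split.

Lemma sq_speed_initial (R : realType) (n : nat) (M : manifold R n)
    (g : tensor2 M) (c : R -> M) x (X : tangent x) i t :
  tensor_law g -> symmetric_tensor g -> regular_metric g ->
  smooth_curve unit_itv c -> euler_lagrange g c -> has_velocity unit_itv c 0 X ->
  inside unit_itv c i t -> sq_speed g c i t = inner g X X.
Proof.
move=> tg sg rg sc ELc [c0 vX] it.
have cx : dom (chart_at x) x by exact: projT2 (cid (dom_cover x)).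
have I0 : inside unit_itv c (chart_at x) 0.
  by split; rewrite /= ?c0// /unit_itv /= in_itv /= lexx ler01.
rewrite (sq_speed_const tg sg rg sc ELc it I0) /sq_speed c0.
by rewrite [velocity _ _ _](vX _ cx).
Qed.

Lemma inner_scale (R : realType) (n : nat) (M : manifold R n)
    (f : M -> R) (g : tensor2 M) x (X Y : tangent x) :
  inner (scale_tensor2 f g) X Y = f x * inner g X Y.
Proof.
have cx : dom (chart_at x) x by exact: projT2 (cid (dom_cover x)).
by rewrite /inner /scale_tensor2 crdK// -scalemxAr -scalemxAl mxE.
Qed.

Theorem theorem3p2 (R : realType) (n1 n2 : nat)
    (M1 : manifold R n1) (M2 : manifold R n2)
    (g1 : tensor2 M1) (g2 : tensor2 M2)
    (g1_riemannian : riemannian g1) (g2_riemannian : riemannian g2)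
    (M1_connected : connected [set: M1]) (M2_connected : connected [set: M2])
    (g1_complete : complete_metric g1) (g2_complete : complete_metric g2)
    (k : M1 -> R) (k_smooth : smooth_function k) (k0_gt0 : 0 < inf (range k))
    (r : R) (k1_lt_r : k1 k < r)
    (mu : R -> M1) (nu : R -> M2)
    (munu_geodesic :
      geodesic
        (prod_metric (scale_tensor2 (fun x => (k x)^-1 + r) g1) g2)
        unit_itv (fun t => (mu t, nu t)))
    (x0 : M1) (y0 : M2) (X0 : tangent x0) (Y0 : tangent y0)
    (mu0 : mu 0 = x0) (nu0 : nu 0 = y0)
    (dmu0 : has_velocity unit_itv mu 0 X0)
    (dnu0 : has_velocity unit_itv nu 0 Y0)
    (phi : R -> R) (phi_spec : phi_reparam k r mu phi)
    (psi : R -> R) (psi_spec : psi_reparam k (mu \o phi) psi)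
    (energy :
      a_const k r mu ^+ 2 * ((1 + r * k x0) / k x0) * inner g1 X0 X0 =
      b_const k (mu \o phi) ^+ 2 * inner g2 Y0 Y0) :
  let gam := mu \o phi in
  let tau := nu \o psi in
  [/\ geodesic (warped_metric g1 g2 k) unit_itv (fun t => (gam t, tau t)),
      (mu 0, nu 0) = (x0, y0) &
      (mu 1, nu 1) = (gam 1, tau 1)].
Proof.
move=> gam tau.
have [[phi' [phiI _ sphi _]] _ phi1 dphi] := phi_spec.
have [[psi' [psiI _ spsi _]] _ psi1 dpsi] := psi_spec.
split; last 2 first.
- by rewrite mu0 nu0.
- by rewrite /gam /tau /= phi1 psi1.
set a := a_const k r mu in energy dphi.
set b := b_const k (mu \o phi) in energy dpsi.
pose f x := (k x)^-1 + r; pose G := scale_tensor2 f g1.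
have kp x : 0 < k x := inf_range_gt0 x k0_gt0.
have kn0 x : k x != 0 by rewrite gt_eqF.
have fp x : 0 < f x := k1_lt_pos x k0_gt0 k1_lt_r.
have fE x : (1 + r * k x) / k x = f x.
  by rewrite mulrDl mul1r mulfK.
have dk i x (ix : dom i x) := smooth_function_diff k_smooth ix.
have df i x : dom i x -> differentiable (f \o par i : _ -> R^o) (crd i x).
  by move=> ix; apply: (differentiable_invD (dk i x ix)); rewrite /= kn0.
have r1 := riemannian_regular g1_riemannian.
have r2 := riemannian_regular g2_riemannian.
have rG : regular_metric G by apply: regular_scale => // x; rewrite gt_eqF.
have [smu snu ELmu ELnu] := geodesic_prod_split rG r2 munu_geodesic.
have phiI' t : unit_itv t -> unit_itv (phi t) by move=> /phiI[].
have psiI' t : unit_itv t -> unit_itv (psi t) by move=> /psiI[].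
have sgam := smooth_curve_reparam smu sphi phiI'.
have stau := smooth_curve_reparam snu spsi psiI'.
have Dphi t : unit_itv t -> has_deriv unit_itv (phi : R -> R^o) t (a * f (gam t)).
  move=> It; have := derivable_inP (sphi 0%N t It).
  by rewrite /= dphi// fE.
have Dpsi t : unit_itv t -> has_deriv unit_itv (psi : R -> R^o) t (b / k (gam t)).
  move=> It; have := derivable_inP (spsi 0%N t It).
  by rewrite /= dpsi.
have dNk i x : dom i x ->
    differentiable ((fun x => - k x) \o par i : _ -> R^o) (crd i x).
  by move=> ix; apply: differentiableN; exact: dk.
have nk0 x : - k x != 0 by rewrite oppr_eq0.
have rw := regular_warped (@warped_metricE _ _ _ _ _ g1 g2 k) r1 r2 dNk nk0.
apply/(geodesicP _ rw); split; first exact/smooth_curve_pair.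
apply/(euler_lagrange_warped (@warped_metricE _ _ _ _ _ g1 g2 k) r1 r2 dNk sgam stau).
move=> i1 i2 t it J x y vx vy.
have [it1 it2] := iffLR (inside_pair _ _ _ _ _) it.
have It : unit_itv t := proj1 it.
have im := inside_reparam phiI' it1; have in' := inside_reparam psiI' it2.
set p := phi t in im; set q := psi t in in'.
set u := crd i1 (mu p).
have vxE s : inside unit_itv gam i1 s ->
    vx s = (a * f (gam s)) *: velocity mu i1 (phi s).
  by move=> is1; apply: velocity_reparam => //; exact: Dphi (proj1 is1).
have vyE s : inside unit_itv tau i2 s ->
    vy s = (b / k (gam s)) *: velocity nu i2 (psi s).
  by move=> is2; apply: velocity_reparam => //; exact: Dpsi (proj1 is2).
have J1 s : J s -> inside unit_itv gam i1 s by move=> /inside_pair[].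
have J2 s : J s -> inside unit_itv tau i2 s by move=> /inside_pair[].
have dg1 : diff_entries (g1 i1) u := proj1 (r1 i1 _ (proj2 im)).
have dg2 : diff_entries (g2 i2) (y t) := proj1 (r2 i2 _ (proj2 in')).
have E1 : f (gam t) * quad (g1 i1 u) (velocity mu i1 p) =
    f x0 * inner g1 X0 X0.
  have [[_ lg1] sg1 _] := g1_riemannian.
  rewrite -inner_scale -/G -(sq_speed_initial _ _ rG smu ELmu dmu0 im).
  - by rewrite /sq_speed /G /scale_tensor2 scale_quad crdK//; exact: (proj2 im).
  - exact: tensor_law_scale.
  - exact: symmetric_scale.
have E2 : quad (g2 i2 (y t)) (velocity nu i2 q) = inner g2 Y0 Y0.
  have [[_ lg2] sg2 _] := g2_riemannian.
  exact: (sq_speed_initial lg2 sg2 r2 snu ELnu dnu0 in').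
(* The energy condition, propagated to the times phi t and psi t. *)
have E12 : a ^+ 2 * (f (gam t) * quad (g1 i1 u) (velocity mu i1 p)) =
    b ^+ 2 * quad (g2 i2 (y t)) (velocity nu i2 q).
  by rewrite E1 E2 -energy fE mulrA.
have dku : differentiable (k \o par i1 : _ -> R^o) u := dk _ _ (proj2 im).
have par_u : par i1 u = gam t by rewrite /u crdK//; exact: (proj2 im).
split.
- have H := has_derivZl a (momentum_reparam (p := phi) phiI' ELmu it1 (Dphi t It)).
  have {}H := has_deriv_sub J1 H.
  (* On J, the g1-momentum of gam is a times the G-momentum of mu at phi. *)
  suff -> : force (g1 i1) (x t) (vx t) + (2^-1 * quad (g2 i2 (y t)) (vy t)) *:
      grad ((fun z => - k z) \o par i1) (x t) =
      a *: ((a * f (gam t)) *: force (G i1) (crd i1 (mu (phi t)))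
        (velocity mu i1 (phi t))).
    apply: has_deriv_eq it H => s; rewrite inE => Js.
    rewrite /= /momentum (vxE s (J1 s Js)) /G /scale_tensor2 /=.
    rewrite crdK; last exact: (proj2 (J1 s Js)).
    by rewrite linearZ /= -scalemxAr -scalemxAl scalerA.
  rewrite (vxE t it1) (vyE t it2) -/p -/q -/u.
  have -> : x t = u by [].
  rewrite forceZ// quadZ.
  rewrite (force_scale _ (df _ _ (proj2 im)) dg1) /= -/u.
  rewrite (gradN dku) (grad_invD dku) /= par_u//.
  rewrite !scalerDr !scalerA; congr (_ *: _ + _).
    by ring.
  rewrite scalerN -scaleNr; congr (_ *: _).
  have := E12; set q1 := quad _ _; set q2 := quad _ _ => E.
  have -> : (b / k (gam t)) ^+ 2 * q2 = (b ^+ 2 * q2) * k (gam t) ^- 2.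
    by field; exact: kn0.
  rewrite -E; ring.
- have H := has_derivZl (- b) (momentum_reparam (p := psi) psiI' ELnu it2 (Dpsi t It)).
  have {}H := has_deriv_sub J2 H.
  (* On J, - k times the momentum of tau is - b times that of nu at psi. *)
  suff -> : - k ((mu \o phi) t) *: force (g2 i2) (y t) (vy t) =
      - b *: ((b / k (gam t)) *: force (g2 i2) (crd i2 (nu (psi t)))
        (velocity nu i2 (psi t))).
    apply: has_deriv_eq it H => s; rewrite inE => Js.
    rewrite /= /momentum (vyE s (J2 s Js)) -scalemxAl scalerA mulNr.
    by rewrite mulrC divfK.
  rewrite (vyE t it2) forceZ// !scalerA; congr (_ *: _).
  rewrite -/(gam t) expr2; field.
  exact: kn0.
Qed.
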